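(* Let $f\in\mathscr{M}[\underline x]$. Then $\varphi(f)\ge0$ for every pseudo-moment evaluation $\varphi:\mathscr{M}[\underline x]\to\mathbb{R}$ if and only if there exist $g,h\in\widehat\Omega$ with $h\neq0$ and $f=g/h$ (i.e. $hf=g$).
   Context: Let $\mathbb{R}[\underline x]=\mathbb{R}[x_1,\dots,x_n]$. Let $\mathscr{M}=\mathbb{R}[\mathtt{m}_{i_1,\dots,i_n}\colon (i_1,\dots,i_n)\in\mathbb{N}_0^n]$ be the polynomial ring in countably many indeterminates, with $\mathtt{m}_{0,\dots,0}:=1$, and $\mathscr{M}[\underline x]=\mathscr{M}\otimes_{\mathbb{R}}\mathbb{R}[\underline x]$. Let $\mathtt{m}:\mathscr{M}[\underline x]\to\mathscr{M}$ be the unique $\mathscr{M}$-linear map with $\mathtt{m}(x_1^{i_1}\cdots x_n^{i_n})=\mathtt{m}_{i_1,\dots,i_n}$. A pseudo-moment evaluation is a homomorphism of $\mathbb{R}$-algebras $\varphi:\mathscr{M}[\underline x]\to\mathbb{R}$ with $\varphi(\mathtt{m}(p^2))\ge0$ for all $p\in\mathbb{R}[\underline x]$. Let $\widehat\Omega=\{\sum_i f_{i0}^2\,\mathtt{m}(f_{i1}^2)\cdots\mathtt{m}(f_{ik_i}^2)\colon k_i\in\mathbb{N}_0,\ f_{ij}\in\mathscr{M}[\underline x]\}$ (finite sums), i.e. the preordering of $\mathscr{M}[\underline x]$ generated by the elements $\mathtt{m}(g^2)$, $g\in\mathscr{M}[\underline x]$. *)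

(* Defs.v *)
From HB Require Import structures.
From mathcomp Require Import all_boot all_order all_algebra.
From mathcomp Require Import finmap.
From mathcomp Require Import reals.
From mathcomp.multinomials Require Import monalg.

Set Implicit Arguments.
Unset Strict Implicit.
Unset Printing Implicit Defensive.
Import GRing.Theory Num.Theory.
Local Open Scope ring_scope.

Section PM.
Variables (R : realType) (n : nat).

Definition mindex := {a : 'X_{1..n} | a != onecm _}.
Definition Var : choiceType := (mindex + 'I_n)%type.
Definition Mx := {malg R[{cmonom Var}]}.

Definition xvar (i : 'I_n) : Mx := << ucm (inr i) >>.
Definition mvar (a : 'X_{1..n}) : Mx :=
  match @insub _ (fun a : 'X_{1..n} => a != onecm _) mindex a with
  | Some b => << ucm (inl b) >>
  | None => 1
  end.
Definition xpart (k : {cmonom Var}) : 'X_{1..n} :=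
  \big[@mulcm _/onecm _]_(i < n) expcmn (ucm i) (k (inr i)).
Definition mpart (k : {cmonom Var}) : Mx :=
  \prod_(v <- finsupp k | if v is inl _ then true else false) << ucm v >> ^+ k v.
Definition mm (g : Mx) : Mx :=
  \sum_(k <- msupp g) g@_k *: (mpart k * mvar (xpart k)).
Definition in_Rx (p : Mx) : Prop :=
  forall k, k \in msupp p -> forall v, v \in finsupp k -> exists i, v = inr i.

Definition pseudo_moment_eval (phi : Mx -> R) : Prop :=
  [/\ (forall a b : Mx, phi (a + b) = phi a + phi b),
      (forall a b : Mx, phi (a * b) = phi a * phi b),
      phi 1 = 1,
      (forall (c : R) (a : Mx), phi (c *: a) = c * phi a)
    & (forall p : Mx, in_Rx p -> 0 <= phi (mm (p ^+ 2)))].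

Definition Omega_hat (g : Mx) : Prop :=
  exists s : seq (Mx * seq Mx),
    g = \sum_(t <- s) t.1 ^+ 2 * \prod_(u <- t.2) mm (u ^+ 2).
End PM.

(* Main.v *)
(* If h f = g, then phi(f) >= 0 wherever phi(h) <> 0. The pseudo-moment
   evaluations with phi(h) <> 0 are dense along segments, because pseudo-moment
   sequences form a convex set on which no nonzero polynomial vanishes: moving
   through the monomials x^a in order, one makes m_2a so large that the norm
   m(g_a^2) of the a-th Gram-Schmidt polynomial is positive, avoiding finitely
   many values.

   Conversely, if f is no such quotient, then the fractions p / q^2 with
   p in Omega - f Omega form a proper cone, which extends to a real closed field
   K in which f < 0 and all the nonzero m(g^2) are positive. By Tarski transfer
   a real point satisfies f < 0 together with any finitely many of the
   inequalities m(g_a^2) > 0; the remaining ones are then enforced by enlarging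
   moments m_2a that do not occur in f. *)
Require Import Defs.
From HB Require Import structures.
From mathcomp Require Import all_boot all_order all_algebra.
From mathcomp Require Import finmap.
From mathcomp Require Import boolp classical_sets functions filter reals.
From mathcomp.multinomials Require Import monalg.
From mathcomp Require Import polyrcf qe_rcf_th complex closed_field ring zify.
Import Order.TTheory GRing.Theory Num.Theory.
Local Open Scope ring_scope.
Set Implicit Arguments.
Unset Strict Implicit.
Unset Printing Implicit Defensive.

(** * Transfer between real closed fields *)

(** Two infinities shape the proof: there are countably many variables, and being a pseudo-moment
    evaluation is an infinite system of inequalities, whereas transfer handles finitely many
    polynomials. The order on the monomials reconciles them. It goes by the sum of the squares of
    the exponents: by strict convexity, [m_2a] is absent from the Gram matrix of the monomials
    treated before [x^a] and from their products with [x^a], so it can be chosen freely at its turn.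
    Orderings are extended inside one fixed algebraically closed field L, where fields and cones are
    mere subsets and algebraic adjunctions never leave L. This L is an ultrapower of the complex
    numbers, indexed by the real evaluation points of the polynomial ring. The nonnegative elements
    given by a maximal cone order a real closed subfield of L. Transfer rests on the fact that
    solvability of sign conditions in one unknown depends only on the signs of finitely many
    polynomial expressions in the coefficients; Cauchy indices provide these expressions. *)

Section Determined.
Variable A : idomainType.
Implicit Types (K : rcfType) (p : {poly A}).

(* A semantic form of quantifier elimination. *)
Definition determined (X : Type) (Phi : forall K : rcfType, {rmorphism A -> K} -> X) :=
  exists qs : seq A, forall (K K' : rcfType) (s : {rmorphism A -> K})
      (s' : {rmorphism A -> K'}),
    {in qs, forall q, sgz (s q) = sgz (s' q)} -> Phi K s = Phi K' s'.

Lemma determined_const X (x : X) : determined (fun _ _ => x).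
Proof. by exists [::]. Qed.

Lemma determined_sgz a : determined (fun K s => sgz (s a)).
Proof. by exists [:: a] => K K' s s'; apply; rewrite mem_head. Qed.

Lemma determined_comp X Y (g : X -> Y) Phi :
  determined Phi -> determined (fun K s => g (Phi K s)).
Proof. by case=> qs Hqs; exists qs => K K' s s' /Hqs ->. Qed.

Lemma determined_comp2 X Y Z (g : X -> Y -> Z) Phi Psi :
  determined Phi -> determined Psi -> determined (fun K s => g (Phi K s) (Psi K s)).
Proof.
case=> qs Hqs [rs Hrs]; exists (qs ++ rs) => K K' s s' H.
congr g; [apply: Hqs|apply: Hrs] => q qin; apply: H;
by rewrite mem_cat qin ?orbT.
Qed.

Lemma determined_ext X (Phi Psi : forall K : rcfType, {rmorphism A -> K} -> X) :
  (forall K s, Phi K s = Psi K s) -> determined Psi -> determined Phi.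
Proof. by move=> e [qs Hqs]; exists qs => K K' s s' /Hqs; rewrite !e. Qed.

Lemma determined_if X (B : forall K : rcfType, {rmorphism A -> K} -> bool)
    (Phi Phi1 Phi2 : forall K : rcfType, {rmorphism A -> K} -> X) :
  determined B -> determined Phi1 -> determined Phi2 ->
  (forall K s, B K s -> Phi K s = Phi1 K s) ->
  (forall K s, ~~ B K s -> Phi K s = Phi2 K s) ->
  determined Phi.
Proof.
move=> dB d1 d2 e1 e2.
apply: (@determined_ext _ _ (fun K s => if B K s then Phi1 K s else Phi2 K s)).
  by move=> K s; case: ifPn => [/e1|/e2].
by apply: (determined_comp2 (fun (b : bool) (x : X * X) => if b then x.1 else x.2)) dB
  (determined_comp2 pair d1 d2).
Qed.

Lemma determined_eq0 a : determined (fun K s => s a == 0).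
Proof.
apply: determined_ext (determined_comp (eq_op^~ 0) (determined_sgz a)).
by move=> K s /=; rewrite sgz_eq0.
Qed.

(** What survives of [p] under a specialisation that kills its leading coefficient. The size drops,
    so the case distinctions on leading coefficients terminate. *)
Definition poly_behead p : {poly A} := p - lead_coef p *: 'X^((size p).-1).

Lemma size_poly_behead p : p != 0 -> (size (poly_behead p) < size p)%N.
Proof.
move=> p0; rewrite (polySpred p0) ltnS; apply/leq_sizeP => j.
rewrite leq_eqVlt => /orP[/eqP<-|lt_j].
  by rewrite coefB coefZ coefXn eqxx mulr1 -lead_coefE subrr.
rewrite coefB coefZ coefXn gtn_eqF // mulr0 subr0 nth_default //.
by rewrite (polySpred p0).
Qed.

Lemma map_poly_behead K (s : {rmorphism A -> K}) p : s (lead_coef p) == 0 ->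
  map_poly s p = map_poly s (poly_behead p).
Proof.
move=> /eqP e; apply/polyP => i.
by rewrite !coef_map /= coefB coefZ rmorphB rmorphM e mul0r subr0.
Qed.

Lemma determined_lead p :
  determined (fun K s => (size (map_poly s p), sgz (lead_coef (map_poly s p)))).
Proof.
have [m] := ubnP (size p); elim: m p => // m IH p; rewrite ltnS => ltm.
have [->|p0] := eqVneq p 0.
  apply: determined_ext (determined_const (0%N, sgz (0 : int))) => K s /=.
  by rewrite rmorph0 size_poly0 lead_coef0 !sgz0.
apply: (determined_if (determined_eq0 (lead_coef p))
  (IH (poly_behead p) (leq_trans (size_poly_behead p0) ltm))
  (determined_comp (fun e => (size p, e)) (determined_sgz (lead_coef p)))) => K s.
  by move=> e; rewrite (map_poly_behead e).
by move=> ne; rewrite size_map_poly_id0 ?lead_coef_map_id0 ?rmorph0.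
Qed.

(** The signs at the two infinities depend only on the sign of the leading coefficient and the
    parity of the degree. *)
Lemma determined_crossR p : determined (fun K s => crossR (map_poly s p)).
Proof.
apply: (determined_ext _ (determined_comp (fun e : nat * int =>
  e.2 * (((-1) ^+ e.1.-1 * e.2 * e.2 < 0)%R : nat)%:Z) (determined_lead p))) => K s /=.
rewrite /crossR /variation /sgp_pinfty /sgp_minfty sgz_sgr.
set c := lead_coef _; set k := (size _).-1.
by rewrite -sgz_lt0 !sgzM !sgz_sgr !sgzM sgzX sgzN1 -[in RHS]sgz_lt0
  !sgzM !sgzX sgzN1 !sgz_id.
Qed.

(** The inversion formula for the Cauchy index, stated for pseudo-division with an arbitrary
    exponent [e]: pseudo-division over [A] specialises to K, but its exponent need not be the one
    found over K. Scaling [p] by the power of the leading coefficient costs the factor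
    [sgz (lead_coef q) ^+ e]. *)
Lemma cindexR_lead_dvd (K : rcfType) (p q d r : {poly K}) e :
  q != 0 -> lead_coef q ^+ e *: p = d * q + r -> (size r < size q)%N ->
  cindexR q p = crossR (p * q) - sgz (lead_coef q) ^+ e * cindexR r q.
Proof.
move=> q0 E ltr; rewrite cindexR_rec; congr (_ + _).
have cZ c u : cindexR (c *: u) q = sgz c * cindexR u q.
  by rewrite /cindexR big_distrr /=; apply: eq_bigr => x _; rewrite jump_mulCp.
have -> : r = lead_coef q ^+ e *: (p %% q).
  by rewrite -modpZl; apply: (modpP E).
have -> : next_mod p q = (- (lead_coef q ^+ Pdiv.Ring.rscalp p q) ^+ 2) *: (p %% q).
  by rewrite /next_mod modpE scalerA mulNr expr2 mulfK // expf_neq0 // lead_coef_eq0.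
have lc2 : sgz (lead_coef q) ^+ 2 = 1 by move: q0; rewrite -lead_coef_eq0; case: sgzP.
by rewrite !cZ sgzN !sgzX -exprM [(_ * 2)%N]mulnC exprM lc2 expr1n mulN1r mulrA
  -expr2 -exprM [(_ * 2)%N]mulnC exprM lc2 expr1n mul1r.
Qed.

Lemma determined_cindexR p q :
  determined (fun K s => cindexR (map_poly s q) (map_poly s p)).
Proof.
have [m] := ubnP (size q); elim: m p q => // m IH p q; rewrite ltnS => ltm.
have [->|q0] := eqVneq q 0.
  apply: (determined_ext _ (determined_const 0)) => K s.
  by rewrite rmorph0 cindexR0p.
have ltr : (size (p %% q)%R < size q)%N by rewrite Pdiv.Idomain.ltn_modp.
set e := scalp p q.
pose Phi2 := fun K (s : {rmorphism A -> K}) => crossR (map_poly s (p * q))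
  - sgz (s (lead_coef q)) ^+ e * cindexR (map_poly s (p %% q)) (map_poly s q).
apply: (determined_if (Phi2 := Phi2) (determined_eq0 (lead_coef q))
  (IH p (poly_behead q) (leq_trans (size_poly_behead q0) ltm))).
- apply: determined_comp2 (determined_crossR _) _.
  apply: (determined_comp2 (fun x y => - (x ^+ e * y))) (determined_sgz _) _.
  exact/IH/(leq_trans ltr).
- by move=> K s e0; rewrite (map_poly_behead e0).
- move=> K s ne; rewrite /Phi2 rmorphM.
  have lcE : lead_coef (map_poly s q) = s (lead_coef q) by rewrite lead_coef_map_id0 ?rmorph0.
  have szE : size (map_poly s q) = size q by rewrite size_map_poly_id0.
  rewrite -lcE; apply: (@cindexR_lead_dvd _ _ _ (map_poly s (p %/ q))).
  + by rewrite -lead_coef_eq0 lcE.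
  + by rewrite lcE -rmorphXn -map_polyZ Pdiv.Idomain.divp_eq rmorphD rmorphM.
  + by rewrite szE (leq_ltn_trans (size_poly _ _)).
Qed.

(** Sturm-Tarski: the Tarski query of [q] at the roots of [p] is the Cauchy index of [p' q / p]. *)
Lemma determined_taq p q :
  determined (fun K s => taq (rootsR (map_poly s p)) (map_poly s q)).
Proof.
apply: (determined_ext _ (determined_cindexR p (p^`() * q))) => K s.
by rewrite taq_taqR /taqR changes_mods_cindex rmorphM deriv_map.
Qed.

(* Each factor [sgz^2 + sgz] is 2 where q > 0 and 0 elsewhere, so for [q0 = 1]
   this counts, up to a power of 2, the points of z where all of sq is positive. *)
Definition pos_weight K (z : seq K) (sq : seq {poly K}) (q0 : {poly K}) : int :=
  \sum_(x <- z) sgz q0.[x] * \prod_(q <- sq) (sgz q.[x] ^+ 2 + sgz q.[x]).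

Lemma pos_weight_gt0 K (z : seq K) sq :
  (0 < pos_weight z sq 1) = has (fun x => all (fun q => 0 < q.[x]) sq) z.
Proof.
rewrite /pos_weight; pose F (x : K) : int := \prod_(q <- sq) (sgz q.[x] ^+ 2 + sgz q.[x]).
have F0 x : 0 <= F x by apply: prodr_ge0 => q _; case: sgzP.
have Fpos x : (0 < F x) = all (fun q => 0 < q.[x]) sq.
  rewrite lt_def F0 andbT prodf_seq_neq0; apply: eq_all => q /=.
  by case: sgzP => //; rewrite ltxx.
under eq_bigr => x _ do rewrite hornerC sgz1 mul1r -/(F x).
rewrite lt_def sumr_ge0 ?andbT; last by move=> x _; exact: F0.
rewrite psumr_eq0; last by move=> x _; exact: F0.
rewrite -has_predC; apply: eq_has => x /=.
by rewrite -Fpos lt_def F0 andbT.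
Qed.

(** Expanding one factor replaces the accumulator [q0] by [q0 q^2] and by [q0 q]; after all
    expansions only Tarski queries remain. *)
Lemma determined_pos_weight p sq q0 : determined (fun K s =>
  pos_weight (rootsR (map_poly s p)) (map (map_poly s) sq) (map_poly s q0)).
Proof.
elim: sq q0 => [|q sq IH] q0.
  apply: (determined_ext _ (determined_taq p q0)) => K s.
  by apply: eq_bigr => x _; rewrite big_nil mulr1.
apply: (determined_ext _ (determined_comp2 +%R (IH (q0 * q ^+ 2)) (IH (q0 * q)))) => K s.
rewrite /pos_weight -big_split; apply: eq_bigr => x _.
rewrite big_cons !rmorphM /= !hornerM !sgzM mulrDl mulrDr !mulrA.
by congr (_ * _ + _); rewrite -mulrA -expr2.
Qed.

Lemma determined_exists_root p sq : determined (fun K s =>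
  has (fun x => all (fun q => 0 < q.[x]) (map (map_poly s) sq)) (rootsR (map_poly s p))).
Proof.
apply: (determined_ext _ (determined_comp (fun w : int => 0 < w) (determined_pos_weight p sq 1))) => K s /=.
by rewrite rmorph1 pos_weight_gt0.
Qed.

Lemma determined_all (X : Type) (l : seq X) (B : X -> forall K : rcfType, {rmorphism A -> K} -> bool) :
  (forall x, determined (B x)) -> determined (fun K s => all (fun x => B x K s) l).
Proof.
move=> dB; elim: l => [|x l IH] /=; first exact: determined_const.
exact: (determined_comp2 andb (dB x) IH).
Qed.

(** The solution set is open. Its components are unbounded on one side, which the signs at infinity
    detect, or bounded by roots of the product of [sq]; in the latter case Rolle's theorem puts a
    root of the derivative of the product, [bounding_poly], inside. *)
Lemma exists_posP K (sq : seq {poly K}) :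
  (exists x, all (fun q => 0 < q.[x]) sq) <->
  [|| all (fun q => 0 < sgz (lead_coef q)) sq,
      all (fun q : {poly K} => 0 < (-1) ^+ (size q).-1 * sgz (lead_coef q)) sq |
      has (fun x => all (fun q => 0 < q.[x]) sq) (rootsR (bounding_poly sq))].
Proof.
have e1 : all (fun q => 0 < sgz (lead_coef q)) sq = all (fun q => 0 < lead_coef q) sq.
  by apply: eq_all => q; rewrite sgz_gt0.
have e2 : all (fun q : {poly K} => 0 < (-1) ^+ (size q).-1 * sgz (lead_coef q)) sq
    = all (fun q : {poly K} => 0 < (-1) ^+ (size q).-1 * lead_coef q) sq.
  by apply: eq_all => q; rewrite -[in RHS]sgz_gt0 sgzM sgzX sgzN1.
rewrite e1 e2; split=> [ex|]; last first.
  case/or3P => [h|h|/hasP[x _ h]]; last by exists x.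
    have [|x] := (bounding_polyP sq).1; first by constructor 1; rewrite big_all.
    by rewrite big_all; exists x.
  have [|x] := (bounding_polyP sq).1; first by constructor 2; rewrite big_all.
  by rewrite big_all; exists x.
have /ccount_gt0P : exists x, \big[andb/true]_(p <- [::] : seq {poly K}) (p.[x] == 0)
    && \big[andb/true]_(q <- sq) (q.[x] > 0).
  by case: ex => x hx; exists x; rewrite big_nil big_all.
rewrite /ccount_gt0 big_nil eqxx /= !big_all => /or3P[->//|->|]; rewrite ?orbT //.
have [b0|b0] := eqVneq (bounding_poly sq) 0.
  by rewrite b0 -constraints1P /rootsR roots0 /constraints big_nil ltxx.
move/(ccount_weakP _ b0) => [x /andP[xr]]; rewrite big_all => hx.
apply/or3P; constructor 3; apply/hasP; exists x => //.
by rewrite -roots_on_rootsR.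
Qed.

Lemma determined_exists_pos sq : determined (fun K s =>
  `[< exists x, all (fun q => 0 < (map_poly s q).[x]) sq >]).
Proof.
have d1 : determined (fun K s => all (fun q => 0 < sgz (lead_coef (map_poly s q))) sq).
  apply: (determined_all _ (B := fun q K s => 0 < sgz (lead_coef (map_poly s q)))) => q.
  exact: (determined_comp (fun e : nat * int => 0 < e.2) (determined_lead q)).
have d2 : determined (fun K s => all (fun q =>
    0 < (-1) ^+ (size (map_poly s q)).-1 * sgz (lead_coef (map_poly s q))) sq).
  apply: (determined_all _ (B := fun q K s =>
    0 < (-1) ^+ (size (map_poly s q)).-1 * sgz (lead_coef (map_poly s q)))) => q.
  exact: (determined_comp (fun e : nat * int => 0 < (-1) ^+ e.1.-1 * e.2)
    (determined_lead q)).
have d3 := determined_comp2 orb d2 (determined_exists_root (\prod_(q <- sq) q)^`() sq).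
have d4 := determined_comp2 orb d1 d3.
refine (determined_ext _ d4) => K s /=.
have E : (exists x, all (fun q => 0 < (map_poly s q).[x]) sq) <->
   (exists x, all (fun q => 0 < q.[x]) (map (map_poly s) sq)).
  by split=> -[x hx]; exists x; move: hx; rewrite all_map.
have bE : bounding_poly (map (map_poly s) sq) = map_poly s (\prod_(q <- sq) q)^`().
  by rewrite /bounding_poly big_map -deriv_map rmorph_prod.
by apply/asboolP/idP; rewrite E exists_posP bE !all_map.
Qed.

(** The equations are merged into the vanishing of a sum of squares [P]. If [P] specialises to 0
    only the inequalities remain; otherwise the candidates are the finitely many roots of [P]. *)
Lemma determined_exists_signs (sp sq : seq {poly A}) : determined (fun K s =>
  `[< exists x, all (fun p => (map_poly s p).[x] == 0) sp
             && all (fun q => 0 < (map_poly s q).[x]) sq >]).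
Proof.
pose P := \sum_(p <- sp) p ^+ 2.
have PE K (s : {rmorphism A -> K}) x :
    ((map_poly s P).[x] == 0) = all (fun p => (map_poly s p).[x] == 0) sp.
  rewrite rmorph_sum horner_sum psumr_eq0; last first.
    by move=> p _; rewrite rmorphXn horner_exp sqr_ge0.
  by apply: eq_all => p; rewrite /= rmorphXn horner_exp expf_eq0.
apply: (determined_if (determined_comp (fun e => e.1 == 0%N) (determined_lead P))
   (determined_exists_pos sq) (determined_exists_root P sq)) => K s /=;
   rewrite size_poly_eq0 => P0.
  apply: asbool_equiv_eq; split=> -[x]; last by exists x; rewrite -PE (eqP P0) horner0 eqxx.
  by case/andP=> _; exists x.
apply/asboolP/hasP => [[x /andP[]]|[x xr]].
  rewrite -PE => xr hx; exists x; last by rewrite all_map.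
  by rewrite -roots_on_rootsR.
rewrite all_map => hx; exists x; rewrite -PE -[_ == 0]/(root _ _).
by rewrite -[root _ _]/(root _ _) [root _ _]roots_on_rootsR // xr.
Qed.

End Determined.

(** * Iterated polynomial rings and transfer in several variables *)

Section IteratedPolynomials.
Variable R : rcfType.

Fixpoint ipoly (n : nat) : idomainType :=
  if n is m.+1 then {poly (ipoly m)} : idomainType else R : idomainType.

Fixpoint ieval (S : comNzRingType) (j : {rmorphism R -> S}) (z : nat -> S) n :
    {rmorphism ipoly n -> S} :=
  match n return {rmorphism ipoly n -> S} with
  | 0 => j
  | m.+1 => (horner_eval (z m) \o map_poly (ieval j z m))%FUN :
              {rmorphism {poly (ipoly m)} -> S}
  end.

Lemma ieval_ext (S : comNzRingType) (j : {rmorphism R -> S}) z z' n p :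
  (forall i, (i < n)%N -> z i = z' i) -> ieval j z n p = ieval j z' n p.
Proof.
elim: n p => //= n IH p e; rewrite /= /horner_eval e //.
by congr (_.[_]); apply: eq_map_poly => c; apply: IH => i /ltnW; exact: e.
Qed.

(** Positive elements of a real closed field are squares, so every ring morphism into an ordered
    field preserves signs. *)
Lemma rmorph_sgz (K : rcfType) (j : {rmorphism R -> K}) c : sgz (j c) = sgz c.
Proof.
have pos x : 0 < x -> 0 < j x.
  move=> x0; rewrite lt_def fmorph_eq0 gt_eqF //= -(sqr_sqrtr (ltW x0)) rmorphXn.
  exact: sqr_ge0.
case: (sgzP c) => [->|/pos/gtr0_sgz //|c0]; first by rewrite rmorph0 sgz0.
by rewrite -[j c]opprK sgzN -rmorphN gtr0_sgz // pos // oppr_gt0.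
Qed.

(** The last variable is eliminated: the existence of a value with the prescribed signs depends on
    the signs of finitely many polynomials [qs] in the other variables, and these are matched by
    induction. *)
Lemma ipoly_transfer (K : rcfType) (j : {rmorphism R -> K}) (z : nat -> K) n
    (ps : seq (ipoly n)) :
  exists y : nat -> R,
    {in ps, forall p, sgz (ieval (idfun : {rmorphism R -> R}) y n p) = sgz (ieval j z n p)}.
Proof.
elim: n ps => [|n IH] ps; first by exists (fun=> 0) => p _; rewrite /= rmorph_sgz.
pose sg (p : ipoly n.+1) := sgz (ieval j z n.+1 p).
pose sp := [seq p <- ps | sg p == 0].
pose sq := [seq p <- ps | sg p == 1] ++ [seq - p | p <- ps & sg p == -1].
have [qs Hqs] := determined_exists_signs sp sq.
have [y Hy] := IH qs.
have /asboolP[x /andP[/allP h0 /allP h1]] : `[< exists x,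
    all (fun p => (map_poly (ieval (idfun : {rmorphism R -> R}) y n) p).[x] == 0) sp &&
    all (fun q => 0 < (map_poly (ieval (idfun : {rmorphism R -> R}) y n) q).[x]) sq >].
  rewrite (Hqs R K _ (ieval j z n)) //; apply/asboolP; exists (z n).
  apply/andP; split; apply/allP => p.
    by rewrite mem_filter sgz_eq0 => /andP[].
  rewrite mem_cat mem_filter => /orP[/andP[]|]; first by rewrite sgz_cp0.
  case/mapP => q; rewrite mem_filter => /andP[+ _] ->.
  by rewrite sgz_cp0 rmorphN hornerN oppr_gt0.
exists (fun i => if i == n then x else y i) => p pin.
have -> : ieval (idfun : {rmorphism R -> R}) (fun i => if i == n then x else y i) n.+1 p
    = (map_poly (ieval (idfun : {rmorphism R -> R}) y n) p).[x].
  rewrite /= /horner_eval eqxx; congr (_.[_]); apply: eq_map_poly => c.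
  by apply: ieval_ext => i; rewrite ltn_neqAle => /andP[/negbTE->].
have [s0|s0|s0] := ltgtP 0 (ieval j z n.+1 p).
- rewrite !gtr0_sgz //; apply: h1.
  by rewrite mem_cat mem_filter /sg gtr0_sgz // eqxx pin.
- rewrite !ltr0_sgz //; have := h1 (- p); rewrite rmorphN hornerN oppr_gt0; apply.
  by rewrite mem_cat map_f ?orbT // mem_filter /sg ltr0_sgz // eqxx.
- have /h0/eqP-> : p \in sp by rewrite mem_filter /sg -s0 sgz0 eqxx.
  by rewrite -s0 !sgz0.
Qed.

Lemma ipoly_nonroot n (p : ipoly n) : p != 0 ->
  exists y : nat -> R, ieval (idfun : {rmorphism R -> R}) y n p != 0.
Proof.
elim: n p => [|n IH] p p0; first by exists (fun=> 0).
have [y yl] : exists y : nat -> R, ieval (idfun : {rmorphism R -> R}) y n (lead_coef p) != 0.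
  by apply: IH; rewrite lead_coef_eq0.
have q0 : map_poly (ieval (idfun : {rmorphism R -> R}) y n) p != 0.
  by rewrite -lead_coef_eq0 lead_coef_map_id0 ?rmorph0.
(* The leading coefficient survives at [y], so the specialised polynomial is nonzero and has no root
   at its Cauchy bound. *)
exists (fun i => if i == n then cauchy_bound (map_poly (ieval (idfun : {rmorphism R -> R}) y n) p) else y i).
rewrite /= /horner_eval eqxx.
have -> : map_poly (ieval (idfun : {rmorphism R -> R}) (fun i => if i == n then
     cauchy_bound (map_poly (ieval (idfun : {rmorphism R -> R}) y n) p) else y i) n) p
   = map_poly (ieval (idfun : {rmorphism R -> R}) y n) p.
  apply: eq_map_poly => c.
  by apply: ieval_ext => i; rewrite ltn_neqAle => /andP[/negbTE->].
by apply: (ge_cauchy_bound q0); rewrite in_itv /= lexx.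
Qed.

Definition iconst n (c : R) : ipoly n :=
  nat_rect (fun n => ipoly n) c (fun n q => q%:P) n.

Lemma ieval_iconst (S : comNzRingType) (j : {rmorphism R -> S}) z n c :
  ieval j z n (iconst n c) = j c.
Proof. by elim: n => //= n IH; rewrite /= /horner_eval map_polyC hornerC. Qed.

Lemma ivarP n i : (i < n)%N ->
  exists q : ipoly n, forall (S : comNzRingType) (j : {rmorphism R -> S}) z,
    ieval j z n q = z i.
Proof.
elim: n => [//|n IH]; rewrite ltnS leq_eqVlt; case: eqP => [-> _|_ /= /IH[q Hq]].
  by exists 'X => S j z; rewrite /= /horner_eval map_polyX hornerX.
by exists q%:P => S j z; rewrite /= /horner_eval map_polyC hornerC; exact: Hq.
Qed.

End IteratedPolynomials.

(** * Real closures inside an algebraically closed field *)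

(** Reduces closure under inverses to closure under products and under squares of inverses. *)
Lemma invr_sqrE (F : fieldType) (x : F) : x^-1 = x * x^-1 ^+ 2.
Proof. by have [->|x0] := eqVneq x 0; rewrite ?invr0 ?mul0r // expr2 mulrA mulfV ?mul1r. Qed.

Section Cones.
Variable L : closedFieldType.
Implicit Types (T : set L) (x y a : L).

(* The subfield in play is the difference set [T - T], so that a cone carries its
   own field and Zorn's lemma applies to subsets of L. *)
Record cone T : Prop := Cone {
  cone1 : T 1;
  coneD : forall x y, T x -> T y -> T (x + y);
  coneM : forall x y, T x -> T y -> T (x * y);
  cone_sqrB : forall x y, T x -> T y -> T ((x - y) ^+ 2);
  coneV : forall x, T x -> T x^-1;
  coneN1 : ~ T (-1) }.

(** Zorn's lemma is applied to the sets whose union with [T0] is a cone, so that the empty chain has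
    an admissible union as well. *)
Lemma cone_maximal T0 : cone T0 -> exists T,
  [/\ cone T, (T0 `<=` T)%classic & forall T', cone T' -> (T `<=` T' -> T' `<=` T)%classic].
Proof.
move=> cT0.
have [F FP tot|A [cA Amax]] := @Zorn_bigcup L (fun X => cone (X `|` T0)%classic).
  set U := (\bigcup_(X in F) X)%classic.
  have two x y : (U `|` T0)%classic x -> (U `|` T0)%classic y ->
      exists X : set L, [/\ cone (X `|` T0)%classic, (X `<=` U)%classic,
        (X `|` T0)%classic x & (X `|` T0)%classic y].
    have sub X : F X -> (X `<=` U)%classic by move=> FX z Xz; exists X.
    case=> [[X FX Xx]|T0x] [[Y FY Yy]|T0y].
    - have [XY|YX] := tot _ _ FX FY.
        by exists Y; split; [exact: FP|exact: sub|left; exact: XY|left].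
      by exists X; split; [exact: FP|exact: sub|left|left; exact: YX].
    - by exists X; split; [exact: FP|exact: sub|left|right].
    - by exists Y; split; [exact: FP|exact: sub|right|left].
    - by exists set0; rewrite set0U; split.
  have up X z : (X `<=` U)%classic -> (X `|` T0)%classic z -> (U `|` T0)%classic z.
    by move=> XU [/XU|]; [left|right].
  split.
  - by right; exact: cone1.
  - by move=> x y hx hy; have [X [cX XU Xx Xy]] := two _ _ hx hy; apply: up XU _; exact: coneD.
  - by move=> x y hx hy; have [X [cX XU Xx Xy]] := two _ _ hx hy; apply: up XU _; exact: coneM.
  - by move=> x y hx hy; have [X [cX XU Xx Xy]] := two _ _ hx hy; apply: up XU _; exact: cone_sqrB.
  - by move=> x hx; have [X [cX XU Xx _]] := two _ _ hx hx; apply: up XU _; exact: coneV.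
  - by move=> h; have [X [cX XU]] := two _ _ h h; move/(coneN1 cX).
exists (A `|` T0)%classic; split=> [||T' cT' sub z T'z] //.
apply: contrapT => nz; apply: (Amax T').
  split; first by move=> w Aw; apply: sub; left.
  by move=> h; apply: nz; left; apply: h.
suff -> : (T' `|` T0 = T')%classic by [].
by apply/setUidPl => w T0w; apply: sub; right.
Qed.

Section ConeTheory.
Variables (T : set L) (cT : cone T).

Definition cone_diff x := exists a b, [/\ T a, T b & x = a - b].

Lemma cone0 : T 0.
Proof. by have := cone_sqrB cT (cone1 cT) (cone1 cT); rewrite subrr expr0n. Qed.

Lemma cone_diff_sqr x : cone_diff x -> T (x ^+ 2).
Proof. by case=> a [b [Ta Tb ->]]; exact: cone_sqrB. Qed.

Lemma cone_sub_diff x : T x -> cone_diff x.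
Proof. by move=> Tx; exists x, 0; rewrite subr0; split=> //; exact: cone0. Qed.

Lemma cone_anti x : T x -> T (- x) -> x = 0.
Proof.
move=> Tx TNx; apply/eqP/negPn/negP => x0; apply: (coneN1 cT).
by rewrite -(mulfV x0) -mulNr; apply: coneM => //; exact: coneV.
Qed.

Lemma cone_diff_divring : [/\ cone_diff 1,
  forall x y, cone_diff x -> cone_diff y -> cone_diff (x - y) &
  forall x y, cone_diff x -> cone_diff y -> cone_diff (x / y)].
Proof.
have dM x y : cone_diff x -> cone_diff y -> cone_diff (x * y).
  case=> a [b [Ta Tb ->]] [c [d [Tc Td ->]]].
  exists (a * c + b * d), (a * d + b * c).
  by split; [apply: coneD => //; exact: coneM|apply: coneD => //; exact: coneM|ring].
split=> [|x y [a [b [Ta Tb ->]]] [c [d [Tc Td ->]]]|x y dx dy].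
- exact: cone_sub_diff (cone1 cT).
- by exists (a + d), (b + c); split; [exact: coneD|exact: coneD|ring].
- apply: (dM) => //.
  by rewrite invr_sqrE exprVn; apply: (dM) => //; apply: cone_sub_diff; apply: coneV => //; exact: cone_diff_sqr.
Qed.

Hypothesis maxT : forall T', cone T' -> (T `<=` T' -> T' `<=` T)%classic.

(** If [-a] is not in T, then [T + aT] is again a cone: an equation [-1 = t + a s] would give
    [-a = (1 + t) / s], which is in T. Maximality then puts [a] into T. *)
Lemma cone_total a : cone_diff a -> T a \/ T (- a).
Proof.
move=> da; have [TNa|nTNa] := pselect (T (- a)); [by right|left].
have [d1 dB dV] := cone_diff_divring.
pose T1 : set L := fun x => exists t s, [/\ T t, T s & x = t + a * s].
have d0 : cone_diff 0 by exact: cone_sub_diff cone0.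
have dD x y : cone_diff x -> cone_diff y -> cone_diff (x + y).
  by move=> dx dy; rewrite -[y]opprK -(sub0r y); apply: (dB) => //; exact: dB.
have dM x y : cone_diff x -> cone_diff y -> cone_diff (x * y).
  by move=> dx dy; rewrite -[y]invrK -[y^-1]mul1r; apply: (dV) => //; exact: dV.
have T1d x : T1 x -> cone_diff x.
  by case=> t [s [Tt Ts ->]]; apply: (dD); [|apply: (dM) => //]; exact: cone_sub_diff.
have TT1 x : T x -> T1 x.
  by move=> Tx; exists x, 0; rewrite mulr0 addr0; split=> //; exact: cone0.
have T1M x y : T1 x -> T1 y -> T1 (x * y).
  move=> [t [s [Tt Ts ->]]] [t' [s' [Tt' Ts' ->]]].
  exists (t * t' + a ^+ 2 * (s * s')), (t * s' + s * t'); split.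
  + apply: coneD => //; first exact: coneM.
    by apply: coneM => //; [exact: cone_diff_sqr|exact: coneM].
  + by apply: coneD => //; exact: coneM.
  + by ring.
suff cT1 : cone T1.
  apply: (maxT cT1) => //; exists 0, 1; rewrite add0r mulr1; split=> //.
    exact: cone0.
  exact: cone1.
split=> //.
- exact: TT1 (cone1 cT).
- move=> x y [t [s [Tt Ts ->]]] [t' [s' [Tt' Ts' ->]]].
  by exists (t + t'), (s + s'); split; [exact: coneD|exact: coneD|ring].
- by move=> x y /T1d dx /T1d dy; apply/TT1/cone_diff_sqr/dB.
- move=> x T1x; rewrite invr_sqrE; apply: (T1M) => //; apply/TT1/cone_diff_sqr.
  by rewrite -[x^-1]mul1r; apply: (dV) => //; exact: T1d.
- case=> t [s [Tt Ts e]]; apply: nTNa.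
  have s0 : s != 0.
    apply/eqP => s0; apply: (coneN1 cT); by rewrite e s0 mulr0 addr0.
  have -> : - a = (1 + t) * s^-1.
    apply: (mulIf s0); rewrite divfK // mulNr.
    have : 1 + (t + a * s) = 0 by rewrite -e subrr.
    by rewrite addrA => /eqP; rewrite addr_eq0 => /eqP->.
  by apply: coneM => //; [apply: coneD => //; exact: cone1|exact: coneV].
Qed.

End ConeTheory.
End Cones.

(** * The real closed field of a maximal cone *)

Record maxcone (L : closedFieldType) := MaxCone {
  mcset : set L;
  mcset_cone : cone mcset;
  mcset_max : forall T', cone T' -> (mcset `<=` T' -> T' `<=` mcset)%classic }.

Section MaxConeField.
Variables (L : closedFieldType) (P : maxcone L).
Let T := mcset P.
Let cT : cone T := mcset_cone P.

Definition mcpred : {pred L} := fun x => `[< cone_diff T x >].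

Fact mcpred_divring : divring_closed mcpred.
Proof.
have [d1 dB dV] := cone_diff_divring cT.
split=> [|x y|x y]; rewrite !unfold_in; first exact/asboolP.
  by move=> /asboolP dx /asboolP dy; apply/asboolP/dB.
by move=> /asboolP dx /asboolP dy; apply/asboolP/dV.
Qed.

HB.instance Definition _ := GRing.isDivringClosed.Build L mcpred mcpred_divring.

Record mcfield := McField { mcval : L; _ : mcval \in mcpred }.
HB.instance Definition _ := [isSub for mcval].
HB.instance Definition _ := [Choice of mcfield by <:].
HB.instance Definition _ := [SubChoice_isSubIntegralDomain of mcfield by <:].
HB.instance Definition _ := [SubIntegralDomain_isSubField of mcfield by <:].

Let val_diff (x : mcfield) : cone_diff T (val x).
Proof. by case: x => x h; apply/asboolP. Qed.

Definition mcle (x y : mcfield) := `[< T (val (y - x)) >].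
Definition mclt (x y : mcfield) := (y != x) && mcle x y.
Definition mcnorm (x : mcfield) := if mcle 0 x then x else - x.

Let mcle0 x : mcle 0 x = `[< T (val x) >].
Proof. by rewrite /mcle subr0. Qed.
Let mcle0N x : mcle x 0 = `[< T (- val x) >].
Proof. by rewrite /mcle sub0r rmorphN. Qed.

Fact mcle0_add x y : mcle 0 x -> mcle 0 y -> mcle 0 (x + y).
Proof.
rewrite !mcle0 => /asboolP Tx /asboolP Ty; apply/asboolP.
by rewrite rmorphD; exact: coneD.
Qed.

Fact mcle0_mul x y : mcle 0 x -> mcle 0 y -> mcle 0 (x * y).
Proof.
rewrite !mcle0 => /asboolP Tx /asboolP Ty; apply/asboolP.
by rewrite rmorphM; exact: coneM.
Qed.

Fact mcle0_anti x : mcle 0 x -> mcle x 0 -> x = 0.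
Proof.
rewrite mcle0 mcle0N => /asboolP Tx /asboolP TNx; apply: val_inj.
by rewrite rmorph0; exact: (cone_anti cT).
Qed.

Fact mcsub_ge0 x y : mcle 0 (y - x) = mcle x y.
Proof. by rewrite mcle0. Qed.

Fact mcle0_total x : mcle 0 x || mcle x 0.
Proof.
rewrite mcle0 mcle0N; apply/orP.
by have [Tx|Tx] := cone_total cT (@mcset_max _ P) (val_diff x); [left|right]; apply/asboolP.
Qed.

Fact mcnormN x : mcnorm (- x) = mcnorm x.
Proof.
rewrite /mcnorm; have e : mcle 0 (- x) = mcle x 0 by rewrite mcle0 mcle0N rmorphN.
rewrite e opprK; case: ifP => [h|h]; case: ifP => [h'|h'] //.
  by rewrite (mcle0_anti h' h) oppr0.
by have := mcle0_total x; rewrite h h'.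
Qed.

Fact mcge0_norm x : mcle 0 x -> mcnorm x = x.
Proof. by rewrite /mcnorm => ->. Qed.

HB.instance Definition _ := Num.IntegralDomain_isLeReal.Build mcfield
  mcle0_add mcle0_mul mcle0_anti mcsub_ge0 mcle0_total mcnormN mcge0_norm
  (fun x y => erefl (mclt x y)).

Lemma mcfield_ge0 (x : mcfield) : (0 <= x) = `[< T (val x) >].
Proof. exact: mcle0. Qed.

End MaxConeField.

(** Nonnegative weights are carried along because square roots of nonnegative elements of F are not
    yet available. *)
Inductive weighted_sos (F : realFieldType) : {poly F} -> Prop :=
| Wsos0 : weighted_sos 0
| WsosD c q r : 0 <= c -> weighted_sos r -> weighted_sos (c *: q ^+ 2 + r).

Section WeightedSos.
Variable F : realFieldType.
Implicit Types w v q p : {poly F}.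

Lemma weighted_sosD w v : weighted_sos w -> weighted_sos v -> weighted_sos (w + v).
Proof.
move=> hw hv; elim: hw => [|c q r c0 _ IH]; first by rewrite add0r.
by rewrite -addrA; exact: WsosD.
Qed.

Lemma weighted_sosZ_sqr c q : 0 <= c -> weighted_sos (c *: q ^+ 2).
Proof. by move=> c0; rewrite -[_ *: _]addr0; apply: WsosD => //; exact: Wsos0. Qed.

Lemma weighted_sos_sqr q : weighted_sos (q ^+ 2).
Proof. by rewrite -[q ^+ 2]scale1r; exact: weighted_sosZ_sqr. Qed.

Lemma weighted_sosM w v : weighted_sos w -> weighted_sos v -> weighted_sos (w * v).
Proof.
move=> hw hv; elim: hw => [|c q r c0 _ IH]; first by rewrite mul0r; exact: Wsos0.
rewrite mulrDl; apply: weighted_sosD => //.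
elim: hv => [|d q' r' d0 _ IH']; first by rewrite mulr0; exact: Wsos0.
rewrite mulrDr; apply: weighted_sosD => //.
rewrite -scalerAl -scalerAr scalerA -exprMn.
by apply: weighted_sosZ_sqr; exact: mulr_ge0.
Qed.

Lemma weighted_sos_ge0 w x : weighted_sos w -> 0 <= w.[x].
Proof.
elim=> [|c q r c0 _ IH]; first by rewrite horner0.
by rewrite hornerD hornerZ horner_exp addr_ge0 // mulr_ge0 // sqr_ge0.
Qed.

(** Each square is taken of a remainder modulo [p], of size at most [size p - 1], which gives the
    bound [2 size p - 3]. The bound is what makes the cofactor [s] in an identity [1 + w = s p]
    smaller than [p]. *)
Lemma weighted_sos_mod p w : (1 < size p)%N -> weighted_sos w ->
  exists v, [/\ weighted_sos v, (size v <= (size p).*2 - 3)%N & p %| v - w].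
Proof.
move=> p1; elim=> [|c q r c0 _ [v [hv sv dv]]].
  by exists 0; rewrite size_poly0 subrr dvdp0; split=> //; exact: Wsos0.
exists (c *: (q %% p) ^+ 2 + v); split; first exact: WsosD.
  rewrite (leq_trans (size_polyD _ _)) // geq_max sv andbT.
  rewrite (leq_trans (size_scale_leq _ _)) // expr2 (leq_trans (size_polyMleq _ _)) //.
  have aux m k : (1 < k -> m < k -> (m + m).-1 <= k.*2 - 3)%N by lia.
  have : (size (q %% p)%R < size p)%N by rewrite ltn_modp -size_poly_gt0 ltnW.
  exact: aux.
rewrite opprD addrACA; apply: dvdp_add => //.
rewrite -scalerBr -mul_polyC dvdp_mull // subr_sqr dvdp_mulr //.
by rewrite {2}(divp_eq q p) opprD addrCA subrr addr0 dvdpNr dvdp_mull.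
Qed.
End WeightedSos.

Section MaxConeRealClosed.
Variables (L : closedFieldType) (P : maxcone L).
Let T := mcset P.
Let cT : cone T := mcset_cone P.
Let F : realFieldType := mcfield P.

(* Were [p] irreducible with a sign change and without root in [F], the sums
   [c_i q_i(alpha)^2], [c_i >= 0], at a root [alpha] of [p] in [L] would form a
   strictly larger cone. *)
Lemma mcfield_irreducible_root (p : {poly F}) (a b : F) : irreducible_poly p ->
  (forall (q : {poly F}) a b, (size q < size p)%N -> a < b -> q.[a] * q.[b] < 0 ->
     exists2 x, a <= x <= b & root q x) ->
  a < b -> p.[a] * p.[b] < 0 -> exists x, root p x.
Proof.
move=> irr IH ltab pab.
have p1 := irr.1.
pose vL : {rmorphism F -> L} := val.
have [al pal] : exists al, root (map_poly vL p) al.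
  by apply/closed_rootP; rewrite size_map_poly gtn_eqF.
pose ev : {rmorphism {poly F} -> L} := (horner_eval al \o map_poly vL)%FUN.
have evp : ev p = 0 by exact/eqP.
have ev0 q : ev q = 0 -> p %| q.
  move=> q0; apply/negPn; rewrite -(irreducible_poly_coprime q irr).
  apply/negP => /Bezout_eq1_coprimepP[[u v] /= /(congr1 ev)].
  by rewrite rmorphD !rmorphM evp q0 !mulr0 addr0 rmorph1 => /eqP; rewrite eq_sym oner_eq0.
have evV q : exists v, ev v = (ev q)^-1.
  have [q0|q0] := eqVneq (ev q) 0; first by exists 0; rewrite q0 invr0 rmorph0.
  have /Bezout_eq1_coprimepP[[u v] /= /(congr1 ev)] : coprimep p q.
    rewrite (irreducible_poly_coprime q irr); apply/negP => /dvdpP[d e].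
    by move: q0; rewrite e rmorphM evp mulr0 eqxx.
  rewrite rmorphD !rmorphM evp mulr0 add0r rmorph1 => e; exists v.
  by apply: (mulIf q0); rewrite e mulVf.
have evC (c : F) : ev c%:P = val c.
  by rewrite -[ev _]/((map_poly vL c%:P).[al]) map_polyC hornerC.
pose T2 : set L := fun x => exists2 w, weighted_sos w & x = ev w.
have T2M x y : T2 x -> T2 y -> T2 (x * y).
  by case=> w hw -> [v hv ->]; exists (w * v); rewrite ?rmorphM //; exact: weighted_sosM.
have cT2 : cone T2.
  split=> //.
  - by exists (1 ^+ 2); [exact: weighted_sos_sqr|rewrite expr1n rmorph1].
  - by move=> x y [w hw ->] [v hv ->]; exists (w + v); rewrite ?rmorphD //; exact: weighted_sosD.
  - move=> x y [w hw ->] [v hv ->]; exists ((w - v) ^+ 2); first exact: weighted_sos_sqr.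
    by rewrite rmorphXn rmorphB.
  - move=> x [w hw ->]; have [v hv] := evV w.
    rewrite invr_sqrE -hv -rmorphXn.
    by apply: T2M; [exists w|exists (v ^+ 2) => //; exact: weighted_sos_sqr].
  (* If -1 were such a sum at [al], then [1 + w = s p] with [s] smaller than [p]. As [1 + w] is at
     least 1 everywhere, [s] changes sign together with [p], hence has a root by [IH], and there
     [1 + w] would vanish. *)
  - case=> w0 /(weighted_sos_mod p1)[w [hw sw dw]] e.
    have /dvdpP[s es] : p %| 1 + w.
      apply: ev0; rewrite rmorphD rmorph1 -[w](subrK w0) rmorphD -e.
      by case/dvdpP: dw => d ->; rewrite rmorphM evp mulr0 add0r subrr.
    have w1 x : 1 <= (1 + w).[x].
      by rewrite hornerD hornerC lerDl weighted_sos_ge0.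
    have s0 : s != 0.
      apply/eqP => s0; have := w1 0; rewrite es s0 mul0r horner0.
      by rewrite ler10.
    have ss : (size s < size p)%N.
      have : (size (s * p)%R <= (size p).*2 - 3)%N.
        rewrite -es (leq_trans (size_polyD _ _)) // geq_max sw size_poly1 andbT.
        by move: p1; case: (size p) => [|[|k]] // _; lia.
      rewrite size_mul // -?size_poly_gt0 ?(ltnW p1) //.
      have := p1; move: (size s) (size p) => k m; lia.
    have sab : s.[a] * s.[b] < 0.
      have : 0 < (s.[a] * s.[b]) * (p.[a] * p.[b]).
        by rewrite mulrACA -!hornerM -es mulr_gt0 // (lt_le_trans ltr01).
      by rewrite nmulr_lgt0.
    have [x _ /eqP sx] := IH s a b ss ltab sab.
    by have := w1 x; rewrite es hornerM sx mul0r ler10.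
have TT2 : (T `<=` T2)%classic.
  move=> x Tx; have xP : x \in mcpred P by apply/asboolP; exact: cone_sub_diff.
  have x0 : 0 <= (McField xP : F) by rewrite mcfield_ge0; exact/asboolP.
  exists ((McField xP : F) *: 1 ^+ 2); first exact: weighted_sosZ_sqr.
  by rewrite expr1n alg_polyC evC.
have T2T := mcset_max cT2 TT2.
(* The identity [x = ((x+1)/2)^2 - ((x-1)/2)^2] writes [al] as a difference of two elements of [T2],
   which is contained in T; so [al] already lies in the field of T. *)
have ale : al = ev ((2^-1 *: ('X + 1)) ^+ 2) - ev ((2^-1 *: ('X - 1)) ^+ 2).
  have -> : al = ev 'X by rewrite -[ev _]/((map_poly vL 'X).[al]) map_polyX hornerX.
  rewrite -rmorphB subr_sqr -scalerBr -scalerDr; congr (ev _).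
  have -> : 'X + 1 - ('X - 1) = 2 :> {poly F} by ring.
  have -> : 'X + 1 + ('X - 1) = 2 * 'X :> {poly F} by ring.
  rewrite -scalerAl -scalerAr scalerA mulrA -natrM mulr_natl -scaler_nat scalerA.
  by rewrite [_ * _%:R](_ : _ = 1) ?scale1r //; field.
have alP : al \in mcpred P.
  have sqT q : T (ev (q ^+ 2)) by apply: T2T; exists (q ^+ 2) => //; exact: weighted_sos_sqr.
  apply/asboolP; exists (ev ((2^-1 *: ('X + 1)) ^+ 2)), (ev ((2^-1 *: ('X - 1)) ^+ 2)).
  by split; [exact: sqT|exact: sqT|exact: ale].
exists (McField alP : F); move: pal.
by rewrite -[al]/(vL (McField alP)) rootE horner_map fmorph_eq0.
Qed.

(** Induction on the size. When [p] factors, one of the factors changes sign. When [p] is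
    irreducible, having a root makes it linear, and the sign change locates that root between [a]
    and [b]. *)
Fact mcfield_ivt : Num.real_closed_axiom F.
Proof.
suff main (p : {poly F}) a b : a < b -> p.[a] * p.[b] < 0 -> exists2 x, a <= x <= b & root p x.
  move=> p a b; rewrite le_eqVlt => /predU1P[<-|ltab] /andP[pa pb].
    by exists a; rewrite ?lexx // rootE eq_le pa pb.
  have [pa0|pa0] := eqVneq p.[a] 0; first by exists a; rewrite ?lexx ?ltW // rootE pa0.
  have [pb0|pb0] := eqVneq p.[b] 0; first by exists b; rewrite ?lexx ?ltW // rootE pb0.
  by apply: main => //; rewrite nmulr_rlt0 lt_neqAle ?pa0 ?pa // eq_sym pb0.
have [m] := ubnP (size p); elim: m p a b => // m IH p a b; rewrite ltnS => ltm ltab pab.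
have p0 : p != 0 by apply/eqP => p0; move: pab; rewrite p0 horner0 mul0r ltxx.
have split_case (q : {poly F}) : (1 < size q)%N -> (size q < size p)%N -> q %| p ->
    exists2 x, a <= x <= b & root p x.
  move=> q1 qp /dvdpP[r e].
  have /norP[r0 q0] : ~~ ((r == 0) || (q == 0)) by rewrite -mulf_eq0 -e.
  have szr : (size r < size p)%N.
    have := size_mul r0 q0; rewrite -e; have := size_poly_gt0 r; rewrite r0.
    by move: q1; move: (size p) (size q) (size r) => i j k; lia.
  have : (r.[a] * r.[b]) * (q.[a] * q.[b]) < 0 by rewrite mulrACA -!hornerM -e.
  have [qab|qab] := ltP (q.[a] * q.[b]) 0.
    move=> _; have [x xab xr] := IH q a b (leq_trans qp ltm) ltab qab.
    by exists x => //; rewrite e rootM xr orbT.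
  move=> h; have rab : r.[a] * r.[b] < 0.
    by rewrite ltNge; apply: contraL h => rab; rewrite -leNgt mulr_ge0.
  have [x xab xr] := IH r a b (leq_trans szr ltm) ltab rab.
  by exists x => //; rewrite e rootM xr.
have p1 : (1 < size p)%N.
  rewrite ltnNge; apply/negP => /size1_polyC e.
  by move: pab; rewrite e !hornerC -expr2 ltNge sqr_ge0.
have [|nex] := pselect (exists2 q : {poly F}, (1 < size q < size p)%N & q %| p).
  by case=> q /andP[q1 qp]; exact: split_case.
have irr : irreducible_poly p.
  split=> // q q1 qp; rewrite -dvdp_size_eqp // eqn_leq dvdp_leq //= leqNgt.
  apply/negP => lt; apply: nex; exists q => //; rewrite lt andbT.
  rewrite ltn_neqAle eq_sym q1 size_poly_gt0.
  by apply: contraTneq qp => ->; rewrite dvd0p.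
have [x xr] : exists x, root p x.
  apply: (mcfield_irreducible_root irr _ ltab pab) => q c d qp.
  exact: IH (leq_trans qp ltm).
exists x => //.
have : 'X - x%:P %= p by apply: irr.2; rewrite ?size_XsubC // dvdp_XsubCl.
rewrite eqp_sym => /eqpP[[c1 c2] /= /andP[c10 c20] e].
have E y : c1 * p.[y] = c2 * (y - x) by rewrite -hornerZ e hornerZ !hornerE.
have : (c2 ^+ 2) * ((a - x) * (b - x)) < 0.
  rewrite expr2 mulrACA -!E mulrACA -expr2 pmulr_rlt0 //.
  by rewrite lt_def sqr_ge0 expf_eq0 c10.
rewrite pmulr_rlt0 => [h|]; last by rewrite lt_def sqr_ge0 expf_eq0 c20.
apply/andP; split; rewrite leNgt; apply/negP => lt; move: h; apply/negP;
  rewrite -leNgt.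
  by rewrite mulr_ge0 // subr_ge0 ltW // (lt_trans lt).
by rewrite mulr_le0 // subr_le0 ltW // (lt_trans ltab).
Qed.

HB.instance Definition _ := Num.RealField_isClosed.Build (mcfield P) mcfield_ivt.

End MaxConeRealClosed.

(** The morphism [s] is [iota] with its codomain restricted to a subfield of L; hence it vanishes
    only where [iota] does. *)
Lemma cone_real_closed (L : closedFieldType) (T0 : set L) (A : comNzRingType)
    (iota : {rmorphism A -> L}) :
  cone T0 -> (forall a, cone_diff T0 (iota a)) ->
  exists (K : rcfType) (s : {rmorphism A -> K}),
    (forall a, T0 (iota a) -> 0 <= s a) /\ (forall a, s a = 0 -> iota a = 0).
Proof.
move=> cT0 dA; have [T [cT T0T Tmax]] := cone_maximal cT0.
pose P := MaxCone cT Tmax.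
have iP a : iota a \in mcpred P.
  apply/asboolP; have [x [y [Tx Ty e]]] := dA a.
  by exists x, y; split=> //; apply: T0T.
pose s a : mcfield P := McField (iP a).
have sB : zmod_morphism s by move=> a b; apply: val_inj; rewrite rmorphB /= rmorphB.
have sM : monoid_morphism s.
  by split=> [|a b]; apply: val_inj; rewrite ?rmorph1 ?rmorphM /= ?rmorph1 ?rmorphM.
pose sr : {rmorphism A -> mcfield P} := HB.pack s
  (GRing.isZmodMorphism.Build _ _ s sB) (GRing.isMonoidMorphism.Build _ _ s sM).
exists (mcfield P : rcfType), sr; split=> a.
  by move=> Ta; rewrite mcfield_ge0; apply/asboolP/T0T.
by move=> /(congr1 val); rewrite rmorph0.
Qed.

(** * Ultrapowers of algebraically closed fields *)

Section Ultrapower.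
Local Open Scope quotient_scope.
Variables (I : pointedType) (C : closedFieldType) (U : set_system I).
Hypothesis uU : UltraFilter U.

Definition uideal : {pred (I -> C)} := fun f => `[< U (fun i => f i = 0) >].

Fact uideal_closed : idealr_closed uideal.
Proof.
have PU : ProperFilter U := ultra_proper.
split=> [||a f g].
- by apply/asboolP; apply: filterS filterT => i _.
- apply/negP => /asboolP h; apply: (@filter_not_empty _ U _).
  by apply: filterS h => i /= /eqP; rewrite /GRing.one /= oner_eq0.
- move=> /asboolP hf /asboolP hg; apply/asboolP; apply: filterS2 hf hg => i /= fi gi.
  by rewrite /Algebra.add /= /GRing.mul /= fi gi mulr0 addr0.
Qed.
HB.instance Definition _ := isIdealr.Build (I -> C) uideal uideal_closed.

Definition upower := {ideal_quot uideal}.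
HB.instance Definition _ := GRing.ComNzRing.on upower.
Implicit Types (f g : I -> C).
Local Notation pi := (\pi_upower : (I -> C) -> upower).

Lemma upower_eq0 f : pi f = 0 <-> U (fun i => f i = 0).
Proof.
have -> : (0 : upower) = pi 0 by rewrite rmorph0.
split=> [/eqP|h].
  by rewrite -Quotient.idealrBE subr0 => /asboolP.
by apply/eqP; rewrite -Quotient.idealrBE subr0; apply/asboolP.
Qed.

Definition uinv (x : upower) : upower := pi (fun i => (repr x i)^-1).

Fact upower_mulVf x : x != 0 -> uinv x * x = 1.
Proof.
move=> x0; have [h|h] := in_ultra_setVsetC (fun i => repr x i = 0) uU.
  by move: x0; rewrite -[x]reprK (upower_eq0 _).2 ?eqxx.
apply/eqP; rewrite -subr_eq0; apply/eqP.
rewrite -[X in _ * X]reprK -rmorphM -(rmorph1 pi) -rmorphB; apply/upower_eq0.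
apply: filterS h => i /= /eqP xi.
by rewrite /Algebra.add /= /Algebra.opp /= /GRing.mul /= mulVf // subrr.
Qed.

Fact upower_inv0 : uinv 0 = 0.
Proof.
apply/upower_eq0; have /upower_eq0 : pi (repr (0 : upower)) = 0 by rewrite reprK.
by apply: filterS => i ->; rewrite invr0.
Qed.

HB.instance Definition _ := GRing.ComNzRing_isField.Build upower upower_mulVf upower_inv0.

(** The coefficients are lifted to representatives and a root is chosen in every coordinate. *)
Fact upower_closed : GRing.closed_field_axiom upower.
Proof.
move=> n P n0.
have /choice[r hr] : forall i, exists x : C, x ^+ n = \sum_(k < n) repr (P k) i * x ^+ k.
  by move=> i; exact: (@solve_monicpoly C n (fun k => repr (P k) i) n0).
exists (pi r); apply/eqP; rewrite -subr_eq0; apply/eqP.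
have -> : \sum_(k < n) P k * pi r ^+ k = pi (\sum_(k < n) repr (P k) * r ^+ k).
  by rewrite rmorph_sum; apply: eq_bigr => k _; rewrite rmorphM rmorphXn; congr (_ * _); exact/esym/reprK.
rewrite -rmorphXn -rmorphB; apply/upower_eq0.
apply: filterS filterT => i _.
rewrite /Algebra.add /= /Algebra.opp /= exprfctE fct_sumE hr.
rewrite [X in _ - X](_ : _ = \sum_(k < n) repr (P k) i * r i ^+ k) ?subrr //.
by apply: eq_bigr => k _; rewrite [LHS]/= /GRing.mul /= exprfctE.
Qed.
HB.instance Definition _ := Field_isAlgClosed.Build upower upower_closed.

End Ultrapower.

(** The nonvanishing sets of nonzero elements generate a proper filter: [sep] makes them nonempty,
    and [dom] makes the intersection of two of them contain a third. Modulo an ultrafilter above it,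
    no nonzero element becomes 0. *)
Lemma closed_field_embedding (A : comNzRingType) (C : closedFieldType) (I : pointedType)
    (e : I -> {rmorphism A -> C}) :
  (forall a b : A, a != 0 -> b != 0 -> a * b != 0) ->
  (forall a : A, a != 0 -> exists i, e i a != 0) ->
  exists (L : closedFieldType) (iota : {rmorphism A -> L}), forall a, iota a = 0 -> a = 0.
Proof.
move=> dom sep.
pose G : set_system I := fun X => exists2 a, a != 0 & forall i, e i a != 0 -> X i.
have PG : ProperFilter G.
  split; first by case=> a /sep[i ei] /(_ _ ei).
  split.
  - by exists 1 => //; exact: oner_neq0.
  - move=> X Y [a a0 aX] [b b0 bY]; exists (a * b); first exact: dom.
    by move=> i; rewrite rmorphM mulf_eq0 negb_or => /andP[/aX ? /bY ?].
  - by move=> X Y XY [a a0 aX]; exists a => // i /aX /XY.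
have [U [uU GU]] := ultraFilterLemma PG.
pose ev (a : A) : I -> C := fun i => e i a.
have evB : zmod_morphism ev.
  by move=> a b; apply/funext => i; rewrite /ev rmorphB.
have evM : monoid_morphism ev.
  by split=> [|a b]; apply/funext => i; rewrite /ev ?rmorph1 ?rmorphM.
pose evr : {rmorphism A -> (I -> C)} := HB.pack ev
  (GRing.isZmodMorphism.Build _ _ ev evB) (GRing.isMonoidMorphism.Build _ _ ev evM).
exists (upower C uU), (\pi_(upower C uU)%qT \o evr)%FUN => a /upower_eq0 h.
apply/eqP/negPn/negP => a0.
have PU : ProperFilter U := ultra_proper.
have : U set0; last exact: filter_not_empty.
have Ua : U (fun i => e i a != 0) by apply: GU; exists a.
by apply: filterS2 h Ua => i /= hi; rewrite -[e i a]/(ev a i) hi eqxx.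
Qed.

(** * Evaluation of polynomials in arbitrarily many variables *)

Section MonomialEvaluation.
Variables (V : choiceType) (S : comNzRingType).
Implicit Types (h : V -> S) (k : {cmonom V}).

Definition moneval h k : S := \prod_(v <- finsupp k) h v ^+ k v.

Lemma monevalEw h k (d : {fset V}) : (finsupp k `<=` d)%fset ->
  moneval h k = \prod_(v <- d) h v ^+ k v.
Proof.
move=> le; rewrite /moneval (big_fset_incl _ le) // => v _.
by rewrite -cmE_neq0 negbK => /eqP->; rewrite expr0.
Qed.

Fact moneval_mmorphism h : mmorphism (moneval h).
Proof.
split=> [a b|]; last by rewrite /moneval mdom1 big_seq_fset0.
rewrite {1}/moneval mdomD (monevalEw _ (fsubsetUl _ (finsupp b))).
rewrite (monevalEw _ (fsubsetUr (finsupp a) _)) -big_split /=.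
by apply: eq_bigr => v _; rewrite cmM exprD.
Qed.
HB.instance Definition _ h := isMultiplicative.Build {cmonom V} S (moneval h)
  (moneval_mmorphism h).

Lemma monevalU h v : moneval h (ucm v) = h v.
Proof. by rewrite /moneval mdomU big_seq_fset1 cmUU expr1. Qed.

Lemma eq_moneval h h' k : {in finsupp k, h =1 h'} -> moneval h k = moneval h' k.
Proof. by move=> e; rewrite /moneval; apply: eq_big_seq => v /e->. Qed.

End MonomialEvaluation.

Lemma cm_prodE (V : choiceType) (T : Type) (s : seq T) (P : pred T)
    (F : T -> {cmonom V}) v :
  (\big[mmul/mone]_(t <- s | P t) F t) v = (\sum_(t <- s | P t) F t v)%N.
Proof. by apply: (big_morph (fun k : {cmonom V} => k v)) => [a b|]; rewrite ?cmM ?cm1. Qed.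

Lemma expcmnE (V : choiceType) (k : {cmonom V}) m v : expcmn k m v = (m * k v)%N.
Proof.
rewrite /expcmn; case: m => [|m]; first by rewrite onecmE.
rewrite iteropS; elim: m => [|m IH]; first by rewrite mul1n.
by rewrite iterS mulcmE IH [in RHS]mulSn.
Qed.

Lemma malgUM (V : choiceType) (R : comNzRingType) (a b : {cmonom V}) :
  << a >> * << b >> = << mmul a b >> :> {malg R[{cmonom V}]}.
Proof. by rewrite malgM_def fgmulUU mulr1. Qed.

Lemma malgU_mul (V : choiceType) (R : comNzRingType) c (k : {cmonom V}) :
  << c *g k >> = c%:MP * << k >> :> {malg R[{cmonom V}]}.
Proof. by rewrite malgM_def fgmulUU mulr1 mul1m. Qed.

Lemma malgU_scale (V : choiceType) (R : comNzRingType) c (k : {cmonom V}) :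
  << c *g k >> = c *: << k >> :> {malg R[{cmonom V}]}.
Proof. exact: etrans (malgU_mul _ _) (mul_malgC _ _). Qed.

Lemma malgUX (V : choiceType) (R : comNzRingType) (a : {cmonom V}) m :
  << a >> ^+ m = << expcmn a m >> :> {malg R[{cmonom V}]}.
Proof.
elim: m => [|m IH]; first by rewrite expr0.
rewrite exprS IH malgUM; congr (<< _ >>); apply/eqP/cmP => v.
by rewrite cmM !expcmnE mulSn.
Qed.

Lemma malg_prodU (V : choiceType) (R : comNzRingType) (T : Type) (s : seq T) (P : pred T)
    (F : T -> {cmonom V}) :
  \prod_(t <- s | P t) << F t >> = << \big[mmul/mone]_(t <- s | P t) F t >>
    :> {malg R[{cmonom V}]}.
Proof. by apply/esym; apply: (big_morph (fun k => << k >>)) => // a b; rewrite malgUM. Qed.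

Lemma malgU_moneval (V : choiceType) (R : comNzRingType) (k : {cmonom V}) :
  << k >> = moneval (fun v => << ucm v >>) k :> {malg R[{cmonom V}]}.
Proof.
rewrite /moneval; under eq_bigr => v _ do rewrite malgUX.
rewrite malg_prodU; congr (<< _ >>); apply/eqP/cmP => v.
rewrite cm_prodE; under eq_bigr => w _ do rewrite expcmnE cmU.
have [vk|vk] := boolP (v \in finsupp k).
  rewrite (big_fsetD1 v) //= eqxx muln1 big1_fset ?addn0 // => w.
  by rewrite in_fsetD1 => /andP[/negbTE-> _] _; rewrite muln0.
rewrite big1_fset => [|w wk _]; first by apply/eqP; rewrite cmE_eq0.
by case: eqP wk vk => [-> ->|]; rewrite ?muln0.
Qed.

Section Evaluation.
Variables (V : choiceType) (R S : comNzRingType) (j : {rmorphism R -> S}).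
Implicit Types (h : V -> S) (p : {malg R[{cmonom V}]}).

Definition meval h : {rmorphism {malg R[{cmonom V}]} -> S} := mmap j (moneval h).

Lemma mevalE h p : meval h p = \sum_(k <- msupp p) j p@_k * moneval h k.
Proof. by []. Qed.

Lemma mevalU h c k : meval h << c *g k >> = j c * moneval h k.
Proof. by rewrite /meval /= mmapU. Qed.

Lemma mevalX h v : meval h << ucm v >> = h v.
Proof. by rewrite mevalU rmorph1 mul1r monevalU. Qed.

Lemma mevalZ h c p : meval h (c *: p) = j c * meval h p.
Proof. by rewrite /meval /= mmapZ. Qed.

Lemma eq_meval h h' p :
  (forall k, k \in msupp p -> {in finsupp k, h =1 h'}) -> meval h p = meval h' p.
Proof. by move=> e; rewrite !mevalE; apply: eq_big_seq => k /e/eq_moneval->. Qed.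

Lemma meval_rmorph (s : {rmorphism {malg R[{cmonom V}]} -> S}) p :
  (forall c : R, s (c%:MP) = j c) -> s p = meval (fun v => s << ucm v >>) p.
Proof.
move=> sC; rewrite mevalE {1}[p]monalgE rmorph_sum; apply: eq_bigr => k _.
rewrite malgU_mul [LHS](rmorphM s); congr (_ * _); first exact: sC.
rewrite malgU_moneval /moneval [LHS](rmorph_prod s).
by apply: eq_bigr => v _; rewrite [LHS](rmorphXn s).
Qed.

End Evaluation.

Lemma meval_id (V : choiceType) (R : comNzRingType) (p : {malg R[{cmonom V}]}) :
  meval (@malgC {cmonom V} R) (fun v => << ucm v >>) p = p.
Proof. by rewrite -(meval_rmorph (j := @malgC {cmonom V} R) (s := idfun)). Qed.

Section FinitelyManyVariables.
Variables (V : choiceType) (R : rcfType).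
Implicit Types (p : {malg R[{cmonom V}]}) (vs : seq V).
Local Notation idR := (idfun : {rmorphism R -> R}).

(* Uniformity in S lets one take S := {malg R[{cmonom V}]}, where meval is the
   identity, to see that a nonzero p has a nonzero representative. *)
Definition represented vs
    (F : forall S : comNzRingType, {rmorphism R -> S} -> (V -> S) -> S) :=
  exists q : ipoly R (size vs), forall (S : comNzRingType) (j : {rmorphism R -> S}) h,
    F S j h = ieval j (nth 0 (map h vs)) (size vs) q.

Lemma represented_sum (T : eqType) vs (s : seq T)
    (F : T -> forall S : comNzRingType, {rmorphism R -> S} -> (V -> S) -> S) :
  (forall t, t \in s -> represented vs (F t)) ->
  represented vs (fun S j h => \sum_(t <- s) F t S j h).
Proof.
elim: s => [|t s IH] rF; first by exists 0 => S j h; rewrite big_nil rmorph0.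
have [q hq] := rF t (mem_head _ _).
have [r hr] : represented vs (fun S j h => \sum_(t <- s) F t S j h).
  by apply: IH => u us; apply: rF; rewrite in_cons us orbT.
by exists (q + r) => S j h; rewrite big_cons rmorphD hq hr.
Qed.

Lemma represented_prod (T : eqType) vs (s : seq T)
    (F : T -> forall S : comNzRingType, {rmorphism R -> S} -> (V -> S) -> S) :
  (forall t, t \in s -> represented vs (F t)) ->
  represented vs (fun S j h => \prod_(t <- s) F t S j h).
Proof.
elim: s => [|t s IH] rF; first by exists 1 => S j h; rewrite big_nil rmorph1.
have [q hq] := rF t (mem_head _ _).
have [r hr] : represented vs (fun S j h => \prod_(t <- s) F t S j h).
  by apply: IH => u us; apply: rF; rewrite in_cons us orbT.
by exists (q * r) => S j h; rewrite big_cons rmorphM hq hr.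
Qed.

Lemma represented_var vs v m : v \in vs -> represented vs (fun S j h => h v ^+ m).
Proof.
move=> vin; have [q hq] : exists q : ipoly R (size vs),
    forall (S : comNzRingType) (j : {rmorphism R -> S}) z,
      ieval j z (size vs) q = z (index v vs) by apply: ivarP; rewrite index_mem.
exists (q ^+ m) => S j h; rewrite rmorphXn hq.
by rewrite (nth_map v) ?index_mem // nth_index.
Qed.

Definition mvars p : seq V :=
  flatten [seq (finsupp (cmonom_val k) : seq V) | k <- (msupp p : seq {cmonom V})].

Lemma mem_mvars p k v : k \in msupp p -> v \in finsupp k -> v \in mvars p.
Proof. by move=> kp vk; apply/flatten_mapP; exists k. Qed.

Lemma represented_malg vs p : {subset mvars p <= vs} ->
  represented vs (fun S j h => meval j h p).
Proof.
move=> sub; have [q hq] : represented vs (fun S j h =>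
    \sum_(k <- msupp p) (j p@_k * moneval h k)); last first.
  by exists q => S j h; rewrite -hq.
apply: represented_sum => k kp.
have [q hq] : represented vs (fun S j h => moneval h k).
  by apply: represented_prod => v vk; apply: represented_var; apply/sub/(mem_mvars kp).
by exists (iconst _ p@_k * q) => S j h; rewrite rmorphM -hq ieval_iconst.
Qed.

Lemma nth_map_index vs (y : nat -> R) i : uniq vs -> (i < size vs)%N ->
  nth 0 (map (fun v => y (index v vs)) vs) i = y i.
Proof.
case: vs => // v0 vs uvs ivs.
by rewrite (nth_map v0) // index_uniq.
Qed.

Lemma malg_transfer (K : rcfType) (j : {rmorphism R -> K}) (z : V -> K)
    (ps : seq {malg R[{cmonom V}]}) :
  exists y : V -> R, {in ps, forall p, sgz (meval idR y p) = sgz (meval j z p)}.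
Proof.
pose vs := undup (flatten (map mvars ps)).
have /choice[rep hrep] : forall p, exists q : ipoly R (size vs), p \in ps ->
    forall (S : comNzRingType) (j : {rmorphism R -> S}) h,
    meval j h p = ieval j (nth 0 (map h vs)) (size vs) q.
  move=> p; have [pin|npin] := boolP (p \in ps); last by exists 0.
  have [|q hq] := @represented_malg vs p; last by exists q.
  by move=> v vp; rewrite mem_undup; apply/flatten_mapP; exists p.
have [y hy] := ipoly_transfer j (nth 0 (map z vs)) (map rep ps).
exists (fun v => y (index v vs)) => p pin.
rewrite !(hrep _ pin) -hy ?map_f //; congr sgz; apply: ieval_ext => i ivs.
by rewrite nth_map_index // undup_uniq.
Qed.

(** Representatives of both factors are multiplied in the integral domain [ipoly], so a common
    nonroot exists; this is also why the polynomial ring has no zero divisors. *)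
Lemma malg_nonroot_mul (a b : {malg R[{cmonom V}]}) : a != 0 -> b != 0 ->
  exists y : V -> R, meval idR y a * meval idR y b != 0.
Proof.
move=> a0 b0; pose vs := undup (mvars a ++ mvars b).
have [|q hq] := @represented_malg vs a; first by move=> v; rewrite mem_undup mem_cat => ->.
have [|r hr] := @represented_malg vs b.
  by move=> v; rewrite mem_undup mem_cat orbC => ->.
have q0 : q != 0 by apply: contraNneq a0 => q0; rewrite -[a]meval_id hq q0 rmorph0.
have r0 : r != 0 by apply: contraNneq b0 => r0; rewrite -[b]meval_id hr r0 rmorph0.
have [y hy] := ipoly_nonroot (mulf_neq0 q0 r0).
exists (fun v => y (index v vs)); rewrite hq hr -rmorphM.
apply: contraNneq hy => <-; apply/eqP/ieval_ext => i ivs.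
by rewrite nth_map_index // undup_uniq.
Qed.

Lemma malg_nonroot p : p != 0 -> exists y : V -> R, meval idR y p != 0.
Proof.
by move=> p0; have [y] := malg_nonroot_mul p0 p0; rewrite mulf_eq0 orbb; exists y.
Qed.

Lemma malg_mulf_neq0 (a b : {malg R[{cmonom V}]}) : a != 0 -> b != 0 -> a * b != 0.
Proof.
move=> a0 b0; have [y] := malg_nonroot_mul a0 b0; rewrite -rmorphM.
by apply: contraNneq => ->; rewrite rmorph0.
Qed.

End FinitelyManyVariables.

(** * Gram-Schmidt orthogonalisation and pseudo-moment evaluations *)

(* Abstracts the map m; its scalars are the elements in which x does not occur. *)
Record expectation (A : comNzRingType) := Expectation {
  expect :> A -> A;
  is_scalar : A -> Prop;
  is_scalar1 : is_scalar 1;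
  is_scalarB : forall c d, is_scalar c -> is_scalar d -> is_scalar (c - d);
  is_scalarM : forall c d, is_scalar c -> is_scalar d -> is_scalar (c * d);
  expectD : forall u w, expect (u + w) = expect u + expect w;
  expect_scalar : forall u, is_scalar (expect u);
  expect_scalarM : forall c u, is_scalar c -> expect (c * u) = c * expect u }.

Section GramSchmidt.
Variables (A : comNzRingType) (E : expectation A).

Lemma expect0 : E 0 = 0.
Proof. by apply: (addrI (E 0)); rewrite -expectD !addr0. Qed.

Lemma expectB u w : E (u - w) = E u - E w.
Proof. by apply: (addIr (E w)); rewrite -expectD !subrK. Qed.

Inductive span (Q : A -> Prop) (l : seq A) : A -> Prop :=
| Span0 : span Q l 0
| SpanD c g u : Q c -> g \in l -> span Q l u -> span Q l (c * g + u).

(** Coefficients may be restricted to a subring of the scalars. With the scalars free of one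
    variable [m_2a], the span lemmas show that everything built from earlier monomials ignores that
    variable. *)
Record scalar_ring (Q : A -> Prop) : Prop := ScalarRing {
  scalar_ring1 : Q 1;
  scalar_ringB : forall c d, Q c -> Q d -> Q (c - d);
  scalar_ringM : forall c d, Q c -> Q d -> Q (c * d);
  scalar_ring_scalar : forall c, Q c -> is_scalar E c }.

Lemma is_scalar_ring : scalar_ring (is_scalar E).
Proof. by split=> //; [exact: is_scalar1|exact: is_scalarB|exact: is_scalarM]. Qed.

Section Span.
Variables (Q : A -> Prop) (rQ : scalar_ring Q).
Implicit Types (G : seq A) (u w r : A).

Lemma scalar_ring0 : Q 0.
Proof. by rewrite -(subrr 1); apply: scalar_ringB => //; exact: scalar_ring1. Qed.

Lemma scalar_ringN c : Q c -> Q (- c).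
Proof. by move=> hc; rewrite -[- c]sub0r; apply: scalar_ringB => //; exact: scalar_ring0. Qed.

Lemma scalar_ringD c d : Q c -> Q d -> Q (c + d).
Proof. by move=> hc hd; rewrite -[d]opprK; apply: scalar_ringB => //; exact: scalar_ringN. Qed.

Lemma span_add G u w : span Q G u -> span Q G w -> span Q G (u + w).
Proof.
move=> hu hw; elim: hu => [|c g u' hc gG _ IH]; first by rewrite add0r.
by rewrite -addrA; exact: SpanD.
Qed.

Lemma span_scale G c u : Q c -> span Q G u -> span Q G (c * u).
Proof.
move=> hc; elim=> [|d g u' hd gG _ IH]; first by rewrite mulr0; exact: Span0.
by rewrite mulrDr mulrA; apply: SpanD => //; exact: scalar_ringM.
Qed.

Lemma span_mem G g : g \in G -> span Q G g.
Proof.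
move=> gG; rewrite -[g]mul1r -[_ * _]addr0; apply: SpanD => //; last exact: Span0.
exact: scalar_ring1.
Qed.

Lemma span_sub G u w : span Q G u -> span Q G w -> span Q G (u - w).
Proof.
move=> hu hw; apply: span_add => //; rewrite -mulN1r; apply: span_scale => //.
exact: scalar_ringN (scalar_ring1 rQ).
Qed.

Lemma span_subset G G' u : {subset G <= G'} -> span Q G u -> span Q G' u.
Proof.
move=> sub; elim=> [|c g w hc gG _ IH]; first exact: Span0.
by apply: SpanD => //; exact: sub.
Qed.

Lemma span_trans G G' u : (forall g, g \in G -> span Q G' g) -> span Q G u -> span Q G' u.
Proof.
move=> sub; elim=> [|c g w hc gG _ IH]; first exact: Span0.
by apply: span_add => //; apply: span_scale => //; exact: sub.
Qed.

Lemma span_cons g G u : span Q (g :: G) u ->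
  exists c w, [/\ Q c, span Q G w & u = c * g + w].
Proof.
elim=> [|c h u' hc hG _ [d [w [hd hw ->]]]].
  by exists 0, 0; rewrite mul0r addr0; split=> //; [exact: scalar_ring0|exact: Span0].
have [->|hg] := eqVneq h g.
  exists (c + d), w; split; [exact: scalar_ringD|exact: hw|].
  by rewrite mulrDl addrA.
exists d, (c * h + w); split; [exact: hd| |exact: addrCA].
by apply: SpanD => //; move: hG; rewrite in_cons (negbTE hg).
Qed.

Lemma expect_linearl c u w : Q c -> E (c * u * w) = c * E (u * w).
Proof. by move=> hc; rewrite -mulrA (expect_scalarM _ (scalar_ring_scalar rQ hc)). Qed.

Lemma expect_span G G' u w : (forall g h, g \in G -> h \in G' -> Q (E (g * h))) ->
  span Q G u -> span Q G' w -> Q (E (u * w)).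
Proof.
move=> hQ hu hw; elim: hu => [|c g u' hc gG _ IH].
  by rewrite mul0r expect0; exact: scalar_ring0.
rewrite mulrDl expectD expect_linearl //; apply: scalar_ringD => //.
apply: scalar_ringM => //; elim: hw => [|d h w' hd hG _ IH'].
  by rewrite mulr0 expect0; exact: scalar_ring0.
rewrite mulrDr expectD mulrCA (expect_scalarM _ (scalar_ring_scalar rQ hd)).
by apply: scalar_ringD => //; apply: scalar_ringM => //; exact: hQ.
Qed.

End Span.

Definition mnorm (g : A) := E (g ^+ 2).

(** Each step is the projection orthogonal to [g], multiplied by the norm of [g] to clear the
    denominator. *)
Fixpoint gs_reduce (G : seq A) (r : A) : A :=
  if G is g :: G' then gs_reduce G' (mnorm g * r - E (r * g) * g) else r.

(* Division-free, so that it lives over the scalars; the list is processed from its end. *)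
Fixpoint gram_schmidt (l : seq A) : seq A :=
  if l is a :: l' then gs_reduce (gram_schmidt l') a :: gram_schmidt l' else [::].

Lemma gs_reduceE (Q : A -> Prop) G r : scalar_ring Q ->
  (forall g h, g \in r :: G -> h \in G -> Q (E (g * h))) ->
  exists2 w, span Q G w & gs_reduce G r = \prod_(g <- G) mnorm g * r + w.
Proof.
move=> rQ; elim: G r => [|g G IH] r hQ /=.
  by exists 0; [exact: Span0|rewrite big_nil mul1r addr0].
have gin : g \in r :: g :: G by rewrite !in_cons eqxx orbT.
have rin : r \in r :: g :: G by rewrite in_cons eqxx.
have Gin h : h \in G -> h \in r :: g :: G by rewrite !in_cons => ->; rewrite !orbT.
set r' := _ - _.
have hr' : span Q (r :: g :: G) r'.
  apply: span_sub => //; apply: span_scale => //; try exact: span_mem.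
    by rewrite /mnorm expr2; apply: hQ => //; rewrite mem_head.
  by apply: hQ => //; rewrite mem_head.
have hin h : h \in r' :: G -> span Q (r :: g :: G) h.
  by rewrite in_cons => /predU1P[->//|/Gin]; exact: span_mem.
have [h1 h2 h1in h2in|w hw ->] := IH r'.
  apply: (expect_span rQ hQ); first exact: hin.
  by apply: (span_mem rQ); rewrite in_cons h2in orbT.
have hP : Q (\prod_(h <- G) mnorm h).
  rewrite big_seq; apply: (big_ind Q) => [||h hG].
  - exact: scalar_ring1.
  - exact: scalar_ringM.
  - by rewrite /mnorm expr2; apply: hQ; [exact: Gin|rewrite in_cons hG orbT].
exists (w - \prod_(h <- G) mnorm h * E (r * g) * g); last first.
  by rewrite big_cons /r'; ring.
apply: span_sub => //.
  by apply: span_subset hw => h hG; rewrite in_cons hG orbT.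
apply: span_scale => //; last by apply: span_mem => //; rewrite mem_head.
by apply: scalar_ringM => //; apply: hQ => //; rewrite mem_head.
Qed.

Lemma gram_schmidt_span (Q : A -> Prop) l : scalar_ring Q ->
  {in l &, forall a b, Q (E (a * b))} ->
  forall g, g \in gram_schmidt l -> span Q (l) g.
Proof.
move=> rQ; elim: l => [//|a l IH] hQ g /=.
have hl : forall g, g \in gram_schmidt l -> span Q ((a :: l)) g.
  have hQl : {in l &, forall b c : A, Q (E (b * c))}.
    by move=> b c bl cl; apply: hQ; rewrite in_cons ?bl ?cl orbT.
  move=> h /(IH hQl).
  by apply: span_subset => u ul; rewrite in_cons ul orbT.
rewrite in_cons => /predU1P[->|/hl //].
have ha : span Q ((a :: l)) a by apply: span_mem => //; rewrite mem_head.
have [|w hw ->] := @gs_reduceE Q (gram_schmidt l) a rQ.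
  have hh h : h \in a :: gram_schmidt l -> span Q ((a :: l)) h.
    by rewrite in_cons => /predU1P[->|/hl].
  move=> h1 h2 /hh h1s /hl h2s; apply: (expect_span rQ) h1s h2s.
  by move=> b c bl cl; exact: hQ.
apply: span_add; last exact: span_trans hl hw.
apply: span_scale => //; rewrite big_seq; apply: (big_ind Q) => [||h hG].
- exact: scalar_ring1.
- exact: scalar_ringM.
- rewrite /mnorm expr2; apply: (expect_span rQ) (hl _ hG) (hl _ hG).
  by move=> b c bl cl; exact: hQ.
Qed.

Lemma mnorm_scalar g : (is_scalar E) (mnorm g).
Proof. exact: expect_scalar. Qed.

(** The first step makes the vector orthogonal to [g0]; the later ones multiply it by a scalar and
    add combinations of elements already orthogonal to [g0]. *)
Lemma gs_reduce_orth G r : pairwise (fun g h => E (g * h) == 0) G ->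
  forall g, g \in G -> E (gs_reduce G r * g) = 0.
Proof.
elim: G r => [//|g0 G IH] r /= /andP[/allP orth0 orthG] g.
rewrite in_cons => /predU1P[->|gG]; last exact: IH.
have [|w hw ->] := @gs_reduceE (is_scalar E) G (mnorm g0 * r - E (r * g0) * g0) is_scalar_ring.
  by move=> *; exact: expect_scalar.
have hP : is_scalar E (\prod_(h <- G) mnorm h).
  apply: (big_ind (is_scalar E)) => [||h _]; last exact: mnorm_scalar.
    exact: is_scalar1.
  exact: is_scalarM.
have e0 : E ((mnorm g0 * r - E (r * g0) * g0) * g0) = 0.
  rewrite mulrBl expectB -!mulrA !(expect_scalarM _ (expect_scalar _ _)).
  by rewrite -/(g0 ^+ 2) -[E (g0 * g0)]/(mnorm g0) [E (r * g0) * _]mulrC subrr.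
rewrite mulrDl expectD -mulrA (expect_scalarM _ hP) e0 mulr0 add0r.
elim: hw => [|c h u hc hG _ IHu]; first by rewrite mul0r expect0.
rewrite mulrDl expectD -mulrA (expect_scalarM _ hc) IHu addr0 [h * g0]mulrC.
by rewrite (eqP (orth0 _ hG)) mulr0.
Qed.

Lemma gram_schmidt_orth l : pairwise (fun g h => E (g * h) == 0) (gram_schmidt l).
Proof.
elim: l => //= a l IH; rewrite IH andbT; apply/allP => g gG.
by rewrite gs_reduce_orth.
Qed.

Lemma mnormD c u w : is_scalar E c ->
  mnorm (c * u + w) = c ^+ 2 * E (u * u) + ((c + c) * E (u * w) + E (w * w)).
Proof.
move=> hc; have hcc := is_scalarM hc hc.
have -> : mnorm (c * u + w) = E (c * c * (u * u) + ((c * (u * w) + c * (u * w)) + w * w)).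
  by congr (E _); ring.
by rewrite !expectD (expect_scalarM _ hcc) !(expect_scalarM _ hc) -mulrDl expr2.
Qed.

Section Positivity.
Variables (R : realFieldType) (phi : {rmorphism A -> R}).

(** By Pythagoras the norm is a sum of terms [c^2 mnorm g]. *)
Lemma orth_span_ge0 G w : pairwise (fun g h => E (g * h) == 0) G ->
  (forall g, g \in G -> 0 <= phi (mnorm g)) ->
  span (is_scalar E) G w -> 0 <= phi (mnorm w).
Proof.
elim: G w => [|g G IH] w /= => [_ _|/andP[/allP orthg orthG] pos].
  case=> [|//]; by rewrite /mnorm expr0n expect0 rmorph0.
case/(span_cons is_scalar_ring) => c [u [hc hu ->]].
have gu : E (g * u) = 0.
  elim: hu => [|d h u' hd hG _ IHu]; first by rewrite mulr0 expect0.
  by rewrite mulrDr expectD IHu addr0 mulrCA (expect_scalarM _ hd) (eqP (orthg _ hG)) mulr0.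
rewrite (mnormD _ _ hc) gu mulr0 add0r -[E (g * g)]/(mnorm g) -[E (u * u)]/(mnorm u).
rewrite rmorphD rmorphM rmorphXn addr_ge0 //.
  by rewrite mulr_ge0 ?sqr_ge0 // pos // mem_head.
by apply: IH => // h hG; apply: pos; rewrite in_cons hG orbT.
Qed.

(** Without division only a multiple [D * u] is known to lie in the span of the orthogonal vectors.
    Here [D] is a product of norms, so strict positivity gives [phi D != 0], and
    [mnorm (D * u) = D^2 mnorm u] allows [D] to be cancelled. *)
Lemma gram_schmidt_ge0 l u : (forall g, g \in gram_schmidt l -> 0 < phi (mnorm g)) ->
  span (is_scalar E) (l) u -> 0 <= phi (mnorm u).
Proof.
move=> pos hu.
have prod_scalar G : (is_scalar E) (\prod_(g <- G) mnorm g).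
  apply: (big_ind (is_scalar E)) => [||h _]; last exact: mnorm_scalar.
    exact: is_scalar1.
  exact: is_scalarM.
have D1 a : a \in l -> exists D, [/\ (is_scalar E) D, phi D != 0 &
    span (is_scalar E) (gram_schmidt l) (D * a)].
  elim: l pos {hu} => [//|b l IH] pos; rewrite in_cons => /predU1P[->|al]; last first.
    have [|//|D [hD D0 sD]] := IH.
      by move=> g gG; apply: pos; rewrite /= in_cons gG orbT.
    by exists D; split=> //; apply: span_subset sD => g gG; rewrite /= in_cons gG orbT.
  have [|w hw e] := @gs_reduceE (is_scalar E) (gram_schmidt l) b is_scalar_ring.
    by move=> *; exact: expect_scalar.
  exists (\prod_(g <- gram_schmidt l) mnorm g); split=> //.
    rewrite rmorph_prod prodf_seq_neq0; apply/allP => g gG /=.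
    by rewrite gt_eqF // pos // /= in_cons gG orbT.
  have -> : \prod_(g <- gram_schmidt l) mnorm g * b
      = gs_reduce (gram_schmidt l) b - w by rewrite e addrK.
  apply: (span_sub is_scalar_ring).
    by apply: (span_mem is_scalar_ring); rewrite /= mem_head.
  by apply: span_subset hw => g gG; rewrite /= in_cons gG orbT.
have [D [hD D0 sD]] : exists D, [/\ (is_scalar E) D, phi D != 0 &
    span (is_scalar E) (gram_schmidt l) (D * u)].
  elim: hu => [|c a w hc al _ [D [hD D0 sD]]].
    exists 1; rewrite mulr0 rmorph1 oner_eq0; split=> //; last exact: Span0.
    exact: is_scalar1.
  have [D' [hD' D'0 sD']] := D1 _ al.
  exists (D * D'); split; first exact: is_scalarM.
    by rewrite rmorphM mulf_neq0.
  have -> : D * D' * (c * a + w) = (D * c) * (D' * a) + D' * (D * w) by ring.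
  by apply: span_add; apply: (span_scale is_scalar_ring) => //;
     exact: is_scalarM.
have : 0 <= phi (mnorm (D * u)).
  apply: orth_span_ge0 sD; first exact: gram_schmidt_orth.
  by move=> g /pos/ltW.
have -> : mnorm (D * u) = D ^+ 2 * mnorm u.
  by rewrite /mnorm exprMn [D ^+ 2]expr2 (expect_scalarM _ (is_scalarM hD hD)).
by rewrite rmorphM rmorphXn pmulr_rge0 // lt_def sqr_ge0 expf_eq0 D0.
Qed.

End Positivity.

End GramSchmidt.

(** * The map m on monomials and the coefficient ring *)

Section Moments.
Variables (R : realType) (n : nat).
Local Notation M := (Mx R n).
Local Notation V := (Var n).
Local Notation mon := 'X_{1..n}.
Implicit Types (k l : {cmonom V}) (a b : mon).

Definition xmon a : {cmonom V} := \big[mmul/mone]_(i < n) expcmn (ucm (inr i)) (a i).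
Definition xpow a : M := << xmon a >>.
Definition mmon k : {cmonom V} :=
  \big[mmul/mone]_(v <- finsupp k | if v is inl _ then true else false) expcmn (ucm v) (k v).

Lemma xpartE k i : xpart k i = k (inr i).
Proof.
rewrite /xpart cm_prodE (bigD1 i) //= expcmnE cmU eqxx muln1 big1 ?addn0 // => l.
by rewrite expcmnE cmU => /negbTE->; rewrite muln0.
Qed.

Lemma xmon_inr a i : xmon a (inr i) = a i.
Proof.
rewrite /xmon cm_prodE (bigD1 i) //= expcmnE cmU eqxx muln1 big1 ?addn0 // => l li.
by rewrite expcmnE cmU [_ == _](negbTE li) muln0.
Qed.

Lemma xmon_inl a (b : mindex n) : xmon a (inl b) = 0%N.
Proof. by rewrite /xmon cm_prodE big1 // => l _; rewrite expcmnE cmU muln0. Qed.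

Lemma mmon_inr k i : mmon k (inr i) = 0%N.
Proof.
rewrite /mmon cm_prodE big1 // => -[b|//] _.
by rewrite expcmnE cmU muln0.
Qed.

Lemma mmon_inl k (b : mindex n) : mmon k (inl b) = k (inl b).
Proof.
rewrite /mmon cm_prodE big_mkcond /=.
have [bk|bk] := boolP (inl b \in finsupp k).
  rewrite (big_fsetD1 (inl b)) //= expcmnE cmU eqxx muln1 big1_fset ?addn0 // => w.
  rewrite in_fsetD1 => /andP[wb _] _; case: w wb => // c cb.
  by rewrite expcmnE cmU (negbTE cb) muln0.
rewrite big1_fset => [|w wk _]; first by apply/eqP; rewrite eq_sym cmE_eq0.
case: w wk => // c ck; rewrite expcmnE cmU; case: eqP ck bk => [-> ->|] //.
by rewrite muln0.
Qed.

Lemma mmon_xmon k : k = mmul (mmon k) (xmon (xpart k)).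
Proof.
apply/eqP/cmP => -[b|i]; rewrite cmM ?mmon_inl ?xmon_inl ?addn0 //.
by rewrite mmon_inr xmon_inr xpartE.
Qed.

Lemma mpartE k : mpart R k = << mmon k >>.
Proof. by rewrite /mpart; under eq_bigr => v _ do rewrite malgUX; rewrite malg_prodU. Qed.

Lemma eq_mmon k l : (forall b : mindex n, k (inl b) = l (inl b)) -> mmon k = mmon l.
Proof.
by move=> e; apply/eqP/cmP => -[b|i]; rewrite ?mmon_inl ?mmon_inr.
Qed.

Lemma mmonM k l : mmon (mmul k l) = mmul (mmon k) (mmon l).
Proof.
by apply/eqP/cmP => -[b|i]; rewrite cmM ?mmon_inl ?mmon_inr // cmM.
Qed.

Lemma xpartM k l : xpart (mmul k l) = mmul (xpart k) (xpart l).
Proof. by apply/eqP/cmP => i; rewrite cmM !xpartE cmM. Qed.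

Lemma xpowM a b : xpow a * xpow b = xpow (mmul a b).
Proof.
rewrite /xpow malgUM; congr (<< _ >>); apply/eqP/cmP => -[c|i].
  by rewrite cmM !xmon_inl.
by rewrite cmM !xmon_inr cmM.
Qed.

Lemma xpart_xmon a : xpart (xmon a) = a.
Proof. by apply/eqP/cmP => i; rewrite xpartE xmon_inr. Qed.

Lemma mmon_xmon1 a : mmon (xmon a) = mone.
Proof. by apply/eqP/cmP => -[b|i]; rewrite ?mmon_inl ?mmon_inr ?xmon_inl cm1. Qed.

Lemma mmon_id k : mmon (mmon k) = mmon k.
Proof. by apply: eq_mmon => b; rewrite mmon_inl. Qed.

Lemma xpart_mmon k : xpart (mmon k) = mone.
Proof. by apply/eqP/cmP => i; rewrite xpartE mmon_inr cm1. Qed.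

Lemma malgU_mpart k : << k >> = mpart R k * xpow (xpart k).
Proof. by rewrite mpartE malgUM -mmon_xmon. Qed.

Lemma mvar1 : mvar R (mone : mon) = 1.
Proof.
have e : ((mone : mon) != onecm 'I_n) = false by apply/negbTE; rewrite negbK; exact: eqxx.
by rewrite /mvar insubF.
Qed.

Lemma mvarN1 a (a1 : a != mone) : mvar R a = << ucm (inl (exist _ a a1 : mindex n)) >>.
Proof. by rewrite /mvar insubT. Qed.

Lemma mmE (g : M) : mm g =
  mmap (@malgC {cmonom V} R) (fun k => mpart R k * mvar R (xpart k)) g.
Proof. by apply: eq_bigr => k _; rewrite mul_malgC. Qed.

Lemma mmD (u w : M) : mm (u + w) = mm u + mm w.
Proof. by rewrite !mmE raddfD. Qed.
Lemma mm0 : mm (0 : M) = 0.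
Proof. by rewrite !mmE raddf0. Qed.
Lemma mm_sum (I : Type) (s : seq I) (P : pred I) (F : I -> M) :
  mm (\sum_(i <- s | P i) F i) = \sum_(i <- s | P i) mm (F i).
Proof. exact: (big_morph _ mmD mm0). Qed.

Lemma mmU c k : mm (<< c *g k >> : M) = c *: (mpart R k * mvar R (xpart k)).
Proof. by rewrite mmE mmapU mul_malgC. Qed.

Lemma mm_xpow a : mm (xpow a) = mvar R a.
Proof. by rewrite mmU xpart_xmon mpartE mmon_xmon1 mul1r scale1r. Qed.

(* Elements of the coefficient ring are those fixed by the substitution [x := 1]. *)
Definition mcoef : {rmorphism M -> M} :=
  meval (@malgC {cmonom V} R) (fun v => if v is inl _ then << ucm v >> else 1).
Definition mscalar (c : M) := mcoef c = c.

Lemma mcoefU k : mcoef << k >> = mpart R k.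
Proof.
rewrite /mcoef mevalU rmorph1 mul1r /moneval /mpart [in RHS]big_mkcond /=.
by apply: eq_bigr => -[b|i] _ //; rewrite expr1n.
Qed.

Lemma mscalar_mpart k : mscalar (mpart R k).
Proof. by rewrite /mscalar mpartE mcoefU mpartE mmon_id. Qed.

Lemma mscalar_mvar a : mscalar (mvar R a).
Proof.
have [->|a1] := eqVneq a mone; first by rewrite mvar1 /mscalar rmorph1.
by rewrite (mvarN1 a1) /mscalar /mcoef mevalX.
Qed.

Lemma mscalarC c : mscalar (c%:MP).
Proof. by rewrite /mscalar /mcoef mevalU /moneval mdom1 big_seq_fset0 mulr1. Qed.

Lemma mscalar_mm u : mscalar (mm u).
Proof.
rewrite /mscalar /mm rmorph_sum; apply: eq_bigr => k _.
by rewrite -mul_malgC !rmorphM (mscalarC _) (mscalar_mpart _) (mscalar_mvar _).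
Qed.

Lemma mm_scalarM c u : mscalar c -> mm (c * u) = c * mm u.
Proof.
move=> <-; rewrite {1 2}[c]monalgE rmorph_sum !mulr_suml mm_sum; apply: eq_bigr => k _.
rewrite [u]monalgE mulr_sumr !mm_sum mulr_sumr; apply: eq_bigr => l _.
have -> : mcoef << c@_k *g k >> = << c@_k *g mmon k >>.
  rewrite (malgU_mul _ k) [LHS](rmorphM mcoef) (malgU_mul _ (mmon k)).
  by congr (_ * _); [exact: mscalarC|rewrite mcoefU mpartE].
have UM z w (a b : {cmonom V}) : << z *g a >> * << w *g b >> = << z * w *g mmul a b >> :> M.
  by rewrite malgM_def fgmulUU.
have mpE : mpart R (mmul (mmon k) l) = << mmon k >> * mpart R l.
  by rewrite !mpartE mmonM mmon_id malgUM.
have xpE : xpart (mmul (mmon k) l) = xpart l by rewrite xpartM xpart_mmon mul1m.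
move: (c@_k) (u@_l) => z w.
rewrite [LHS](congr1 (@mm R n) (UM _ _ _ _)) [LHS]mmU mpE xpE.
rewrite (malgU_scale z) [X in _ = _ * X]mmU; move: << mmon k >> => K.
by rewrite -[RHS]scalerAl -[in RHS]scalerAr scalerA mulrA.
Qed.

Fact mscalarB c d : mscalar c -> mscalar d -> mscalar (c - d).
Proof. by rewrite /mscalar => hc hd; rewrite (rmorphB mcoef) hc hd. Qed.

Fact mscalarM c d : mscalar c -> mscalar d -> mscalar (c * d).
Proof. by rewrite /mscalar => hc hd; rewrite (rmorphM mcoef) hc hd. Qed.

Definition moment_expectation : expectation M :=
  Expectation (rmorph1 mcoef) mscalarB mscalarM mmD mscalar_mm mm_scalarM.

End Moments.

Lemma poly_nonroot_itv (R : realFieldType) (p : {poly R}) d : p != 0 -> 0 < d ->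
  exists2 t, 0 < t < d & p.[t] != 0.
Proof.
(* The points [d/2, d/3, ...] lie strictly between 0 and [d]; there are [size p] of them, more than
   [p] can have roots. *)
move=> p0 d0; pose ts : seq R := [seq d / i.+2%:R | i <- iota 0 (size p)].
have [t tin pt] : exists2 t, t \in ts & ~~ root p t.
  apply/hasP; rewrite has_predC; apply/negP => ar.
  have uts : uniq ts.
    rewrite map_inj_uniq ?iota_uniq // => i k /(mulfI (lt0r_neq0 d0))/invr_inj/eqP.
    by rewrite eqr_nat => /eqP[].
  by have := max_poly_roots p0 ar uts; rewrite size_map size_iota ltnn.
exists t => //; case/mapP: tin => i _ ->.
by rewrite divr_gt0 ?ltr0n // ltr_pdivrMr ?ltr0n // ltr_pMr // ltr1n.
Qed.

Lemma poly_nonroot_gt (R : rcfType) (p : {poly R}) B : p != 0 ->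
  exists2 t, B < t & p.[t] != 0.
Proof.
move=> p0; exists (Num.max (B + 1) (cauchy_bound p)).
  by rewrite lt_max ltrDl ltr01.
by apply: (ge_cauchy_bound p0); rewrite in_itv /= le_max lexx orbT.
Qed.

(** * Choosing the moments: existence, convexity and density *)

Section MomentExtension.
Variables (R : realType) (n : nat).
Local Notation M := (Mx R n).
Local Notation V := (Var n).
Local Notation mon := 'X_{1..n}.
Local Notation E := (moment_expectation R n).
Implicit Types (a b : mon) (y : V -> R) (v w : V) (p h : M).

Definition mev y : {rmorphism M -> R} := meval (idfun : {rmorphism R -> R}) y.
Definition upd y v t : V -> R := fun w => if w == v then t else y w.
Definition var_free v p := forall y t, mev (upd y v t) p = mev y p.
Definition gs_pos y (l : seq mon) :=
  forall g, g \in gram_schmidt E (map (@xpow R n) l) -> 0 < mev y (mnorm E g).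

Lemma mev_var y v : mev y << ucm v >> = y v.
Proof. exact: mevalX. Qed.

Lemma free_scalar_ring v : scalar_ring E (fun c => mscalar c /\ var_free v c).
Proof.
split=> [|c d [sc fc] [sd fd]|c d [sc fc] [sd fd]|c []] //.
- by split; [exact: (is_scalar1 E)|move=> y t; rewrite !rmorph1].
- split; first exact: (is_scalarB (e := E)).
  by move=> y t; rewrite (rmorphB (mev _)) (rmorphB (mev y)) fc fd.
- split; first exact: (is_scalarM (e := E)).
  by move=> y t; rewrite (rmorphM (mev _)) (rmorphM (mev y)) fc fd.
Qed.

Lemma mvar_free a (v : mindex n) : a != val v -> var_free (inl v) (mvar R a).
Proof.
move=> av y t; have [->|a1] := eqVneq a mone; first by rewrite mvar1 !rmorph1.
rewrite (mvarN1 R a1) !mev_var /upd.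
case: eqP => // -[/(congr1 val) /= e]; by rewrite e eqxx in av.
Qed.

Lemma mev_horner (z : V -> {poly R}) p t :
  mev (fun w => (z w).[t]) p = (meval (@polyC R) z p).[t].
Proof.
pose s : {rmorphism M -> R} := (horner_eval t \o meval (@polyC R) z)%FUN.
rewrite -[RHS]/(s p) [RHS](meval_rmorph (j := (idfun : {rmorphism R -> R}))); last first.
  by move=> c; rewrite -[LHS]/((meval (@polyC R) z c%:MP).[t]) mevalU /moneval mdom1 big_seq_fset0 mulr1 hornerC.
apply: eq_meval => k _ w _.
by rewrite -[RHS]/((meval (@polyC R) z << ucm w >>).[t]) mevalX.
Qed.

Lemma mev_updE y v p : exists P : {poly R}, forall t, mev (upd y v t) p = P.[t].
Proof.
exists (meval (@polyC R) (fun w => if w == v then 'X else (y w)%:P) p) => t.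
rewrite -mev_horner; apply: eq_meval => k _ w _; rewrite /upd.
by case: eqP; rewrite ?hornerX ?hornerC.
Qed.

Lemma mev_lineE y0 y1 p : exists P : {poly R},
  forall t, mev (fun w => (1 - t) * y0 w + t * y1 w) p = P.[t].
Proof.
exists (meval (@polyC R) (fun w => (1 - 'X) * (y0 w)%:P + 'X * (y1 w)%:P) p) => t.
by rewrite -mev_horner; apply: eq_meval => k _ w _; rewrite !hornerE.
Qed.

(* The norm of the new Gram-Schmidt vector is a positive multiple of m_2a plus
   terms free of that variable, hence positive once m_2a is large. *)
Lemma gs_pos_extend (l : seq mon) a y h :
  a != mone ->
  {in l &, forall b c, mmul b c != mmul a a} ->
  {in l, forall b, mmul a b != mmul a a} ->
  gs_pos y l -> mev y h != 0 ->
  exists (v : mindex n) t, [/\ val v = mmul a a, gs_pos (upd y (inl v) t) (a :: l) &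
    mev (upd y (inl v) t) h != 0].
Proof.
move=> a1 hll hal pos h0.
have aa1 : mmul a a != mone by rewrite cmM_eq1 (negbTE a1).
pose v : mindex n := exist _ (mmul a a) aa1.
pose Q c := mscalar c /\ var_free (inl v) c.
have rQ : scalar_ring E Q := free_scalar_ring (inl v).
have Qmvar b c : mmul b c != mmul a a -> Q (E (xpow R b * xpow R c)).
  move=> bc; rewrite xpowM -[E _]/(mm _) mm_xpow; split; first exact: mscalar_mvar.
  exact: mvar_free.
set G := gram_schmidt E (map (@xpow R n) l).
have Gspan g : g \in G -> span Q (map (@xpow R n) l) g.
  apply: (gram_schmidt_span rQ).
  by move=> _ _ /mapP[b bl ->] /mapP[c cl ->]; apply/Qmvar/hll.
have Qll g g' : g \in map (@xpow R n) l -> g' \in map (@xpow R n) l -> Q (E (g * g')).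
  by move=> /mapP[b bl ->] /mapP[c cl ->]; apply/Qmvar/hll.
have Qal g g' : g \in [:: xpow R a] -> g' \in map (@xpow R n) l -> Q (E (g * g')).
  by rewrite inE => /eqP-> /mapP[b bl ->]; apply/Qmvar/hal.
have Qnorm g : g \in G -> Q (mnorm E g).
  by move=> gG; rewrite /mnorm expr2; apply: (expect_span rQ Qll); exact: Gspan.
have [g g'|w hw er] := @gs_reduceE _ E Q G (xpow R a) rQ.
  rewrite in_cons => /predU1P[->|gG] g'G.
    by apply: (expect_span rQ Qal (span_mem rQ (mem_head _ _))); exact: Gspan.
  by apply: (expect_span rQ Qll); exact: Gspan.
set P := \prod_(g <- G) mnorm E g in er.
have QP : Q P.
  rewrite /P big_seq; apply: (big_ind Q); [exact: scalar_ring1 rQ|exact: scalar_ringM rQ|].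
  by move=> g; exact: Qnorm.
have wl : span Q (map (@xpow R n) l) w by exact: (span_trans rQ Gspan hw).
set r := gs_reduce E G (xpow R a) in er.
pose c0 := (P + P) * E (xpow R a * w) + E (w * w).
have Qc0 : Q c0.
  apply: (scalar_ringD rQ); last exact: (expect_span rQ Qll).
  apply: (scalar_ringM rQ); first exact: (scalar_ringD rQ).
  exact: (expect_span rQ Qal (span_mem rQ (mem_head _ _))).
have normr : mnorm E r = P ^+ 2 * mvar R (mmul a a) + c0.
  have aE : E (xpow R a * xpow R a) = mvar R (mmul a a).
    by rewrite xpowM; exact: mm_xpow.
  rewrite -aE er; exact: (mnormD (E := E) (xpow R a) w QP.1).
have P0 : 0 < mev y P.
  rewrite /P rmorph_prod big_seq; apply: prodr_gt0 => g gG; exact: pos.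
have [H HE] := mev_updE y (inl v) h.
have H0 : H != 0.
  apply: contraNneq h0 => H0; have := HE (y (inl v)); rewrite H0 horner0 => <-.
  by apply/eqP/eq_meval => k _ u _; rewrite /upd; case: eqP => [->|].
(* Beyond this threshold [P^2 t + c0], the new norm, is positive; avoiding the roots of [H] keeps
   [h] nonzero. *)
have [t tB tH] := poly_nonroot_gt (- mev y c0 / mev y P ^+ 2) H0.
exists v, t; split=> //; last by rewrite HE.
move=> g; rewrite /= in_cons => /predU1P[->|gG]; last first.
  by rewrite (Qnorm _ gG).2; exact: pos.
change (0 < mev (upd y (inl v) t) (mnorm E r)).
have mvv : mev (upd y (inl v) t) (mvar R (mmul a a)) = t.
  by rewrite (mvarN1 R aa1) mev_var /upd eqxx.
rewrite normr rmorphD rmorphM rmorphXn QP.2 Qc0.2 mvv.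
move: tB; rewrite ltr_pdivrMr ?exprn_gt0 // mulrC => tB.
by rewrite -[mev y c0]opprK subr_gt0.
Qed.

(** With [k = |x - z|] one has [z^2 + t^2 = 2 x^2 + 2 k^2]. *)
Lemma sqrn_midpoint (x z t : nat) : (z + t = x + x ->
  2 * x ^ 2 <= z ^ 2 + t ^ 2 ?= iff (z == x))%N.
Proof.
move=> e; have [k [xE zt]] : exists k, (x ^ 2 + x ^ 2 + k ^ 2 + k ^ 2 = z ^ 2 + t ^ 2)%N
    /\ (z == x) = (k == 0)%N.
  have [zx|xz] := leqP z x.
    exists (x - z)%N; have [k xE] : exists k, x = (z + k)%N by exists (x - z)%N; lia.
    have tE : t = (z + k + k)%N by lia.
    by split; [rewrite xE tE addKn -!mulnn; ring|apply/eqP/eqP; lia].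
  exists (x - t)%N; have [k xE] : exists k, x = (t + k)%N by exists (x - t)%N; lia.
  have zE : z = (t + k + k)%N by lia.
  by split; [rewrite xE zE addKn -!mulnn; ring|apply/eqP/eqP; lia].
rewrite zt -xE ssrnat.mul2n -addnn -[X in (_ <= X ?= iff _)%N]addnA; split; first exact: leq_addr.
by rewrite -[X in X == _]addn0 eqn_add2l eq_sym addn_eq0 expn_eq0 andbT andbb.
Qed.

(* Strict convexity of the sum of squares: x^2a is a product of two monomials of
   weight at most that of x^a in the obvious way only. *)
Definition qweight a : nat := (\sum_(i < n) a i ^ 2)%N.

Lemma qweight_sqr a : qweight (mmul a a) = (4 * qweight a)%N.
Proof. by rewrite /qweight big_distrr; apply: eq_bigr => i _; rewrite /= cmM addnn -muln2 expnMn mulnC. Qed.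

Lemma qweight_midpoint a b c : mmul b c = mmul a a ->
  (qweight b <= qweight a)%N -> (qweight c <= qweight a)%N -> b = a.
Proof.
move=> e qb qc; have eE i : (b i + c i = a i + a i)%N by rewrite -!cmM e.
have le : forall i : 'I_n, true ->
    (2 * a i ^ 2 <= b i ^ 2 + c i ^ 2 ?= iff (b i == a i))%N.
  by move=> i _; exact: sqrn_midpoint.
have [le1] := leqif_sum le; rewrite -big_distrr big_split /= => e2.
have : (2 * qweight a == qweight b + qweight c)%N.
  rewrite eqn_leq; apply/andP; split; last by lia.
  by move: le1; rewrite -big_distrr big_split.
rewrite e2 => /forallP be; apply/eqP/cmP => i; exact/eqP/(implyP (be i)).
Qed.

(** Since [k <= k^2], a monomial of weight [d] has exponents at most [d], so a finite search finds
    all of them. *)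
Definition qblock d : seq mon :=
  undup [seq a <- [seq \big[mmul/mone]_(i < n) expcmn (ucm i) (f i : nat)
                  | f : {ffun 'I_n -> 'I_d.+1}] | qweight a == d].

Lemma mem_qblock d a : (a \in qblock d) = (qweight a == d).
Proof.
rewrite mem_undup mem_filter andb_idr // => /eqP ad.
have ale i : (a i < d.+1)%N.
  rewrite ltnS -ad /qweight (bigD1 i) //= (leq_trans _ (leq_addr _ _)) //.
  by case: (a i) => // k; rewrite -mulnn leq_pmulr.
apply/mapP; exists [ffun i => Ordinal (ale i)]; first by rewrite mem_enum.
apply/eqP/cmP => i; rewrite cm_prodE (bigD1 i) //= expcmnE cmU eqxx muln1 ffunE /=.
by rewrite big1 ?addn0 // => k ki; rewrite expcmnE cmU (negbTE ki) muln0.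
Qed.

Fixpoint qball d : seq mon := if d is e.+1 then qblock e ++ qball e else [::].

Lemma mem_qball d a : (a \in qball d) = (qweight a < d)%N.
Proof. by elim: d => //= d IH; rewrite mem_cat IH mem_qblock ltnS [RHS]leq_eqVlt. Qed.

(** The order inside a block is immaterial, since the midpoint property compares weights only
    weakly. Doubling the exponents multiplies the weight by 4, so only variables of weight exactly
    [4 d] change. *)
Lemma gs_pos_block d y h s : {subset s <= qblock d} -> uniq s ->
  gs_pos y (qball d) -> mev y h != 0 ->
  exists y', [/\ gs_pos y' (s ++ qball d), mev y' h != 0 &
    forall w, (forall v : mindex n, w = inl v -> qweight (val v) != (4 * d)%N) -> y' w = y w].
Proof.
move=> + + pos h0; elim: s => [|a s IH] sub /=; first by exists y.
case/andP=> as_ us; have [|y1 [pos1 h1 agree1]] := IH _ us.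
  by move=> b bs; apply: sub; rewrite in_cons bs orbT.
have ad : qweight a = d by apply/eqP; rewrite -mem_qblock; apply: sub; rewrite mem_head.
have bd b : b \in s ++ qball d -> (qweight b <= qweight a)%N /\ b != a.
  rewrite mem_cat => /orP[bs|]; last first.
    rewrite mem_qball ad => bd; split; first exact: ltnW.
    by apply: contraTneq bd => ->; rewrite ad ltnn.
  have : b \in qblock d by apply: sub; rewrite in_cons bs orbT.
  rewrite mem_qblock ad => /eqP->; split=> //.
  by apply: contraNneq as_ => <-.
(* The monomial 1 offers no variable to adjust, as [m_0] is 1. It is the only one of weight 0, so
   nothing precedes it, and its norm is 1. *)
have [a1|a1] := eqVneq a mone.
  have d0 : d = 0%N by rewrite -ad a1 /qweight big1 // => i _; rewrite cm1.
  have nil b : b \notin s ++ qball d.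
    apply/negP => /bd[]; rewrite ad d0 leqn0 => b0 /eqP; apply.
    rewrite a1; apply/eqP/cmP => i; rewrite cm1; move: b0.
    rewrite sum_nat_eq0 => /forallP/(_ i); rewrite expn_eq0 andbT => /eqP->//.
  case: (s ++ qball d) nil => [_|b l /(_ b)]; last by rewrite mem_head.
  exists y1; split=> // g.
  change (g \in [:: xpow R a] -> 0 < mev y1 (mnorm E g)); rewrite inE => /eqP->.
  have -> : mnorm E (xpow R a) = mvar R (mmul a a) by rewrite /mnorm expr2 xpowM; exact: mm_xpow.
  rewrite a1 mulm1 mvar1 rmorph1.
  exact: ltr01.
have [b c bl cl|b bl|v [t [ve pos2 h2]]] := gs_pos_extend a1 _ _ pos1 h1.
- have [[qb ba] [qc _]] := (bd _ bl, bd _ cl).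
  by apply: contraNneq ba => /qweight_midpoint->.
- have [qb ba] := bd _ bl; apply: contraNneq ba; rewrite mulmC => /qweight_midpoint->//.
exists (upd y1 (inl v) t); split=> // w hw; rewrite /upd; case: eqP => [e|_]; last exact: agree1.
by have := hw _ e; rewrite ve qweight_sqr ad eqxx.
Qed.

Lemma gram_schmidt_catr s l : {subset gram_schmidt E l <= gram_schmidt E (s ++ l)}.
Proof. by elim: s => //= a s IH g /IH gs; rewrite in_cons gs orbT. Qed.

Lemma gs_pos_ball_le d e y : (d <= e)%N -> gs_pos y (qball e) -> gs_pos y (qball d).
Proof.
move=> /subnK <-; elim: (e - d)%N => // k IH pos; apply: IH => g gl.
by apply: pos; rewrite /= map_cat; exact: gram_schmidt_catr.
Qed.

(* Each variable is changed at most once, so the successive modifications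
   stabilise pointwise. *)
Lemma gs_pos_complete d y h : gs_pos y (qball d) -> mev y h != 0 ->
  exists y', [/\ forall e, gs_pos y' (qball e), mev y' h != 0 &
    forall w, (forall v : mindex n, w = inl v -> (qweight (val v) < 4 * d)%N) -> y' w = y w].
Proof.
move=> pos0 h0.
pose step k (u u' : V -> R) := gs_pos u (qball k) /\ mev u h != 0 ->
  [/\ gs_pos u' (qball k.+1), mev u' h != 0 &
    forall w, (forall v : mindex n, w = inl v -> qweight (val v) != (4 * k)%N) -> u' w = u w].
have /choice[F HF] : forall ku : nat * (V -> R), exists u', step ku.1 ku.2 u'.
  move=> [k u]; have [[pk hk]|nk] := pselect (gs_pos u (qball k) /\ mev u h != 0); last first.
    by exists u.
  have [|u' Hu'] := @gs_pos_block k u h (qblock k) (fun _ => id) _ pk hk.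
    exact: undup_uniq.
  by exists u'.
pose Y := fix Y k := if k is j.+1 then F ((d + j)%N, Y j) else y.
have YP k : gs_pos (Y k) (qball (d + k)) /\ mev (Y k) h != 0.
  elim: k => [|k IH]; first by rewrite addn0.
  by have [p1 p2 _] := HF ((d + k)%N, Y k) IH; rewrite addnS.
have Ystep k w : (forall v : mindex n, w = inl v -> qweight (val v) != (4 * (d + k))%N) ->
    Y k.+1 w = Y k w.
  by have [_ _] := HF ((d + k)%N, Y k) (YP k); exact.
have Ystable k k' w : (k <= k')%N ->
    (forall v : mindex n, w = inl v -> (qweight (val v) < 4 * (d + k))%N) -> Y k' w = Y k w.
  move=> /subnK <- hw; elim: (k' - k)%N => // j IH; rewrite addSn Ystep //.
  by move=> v /hw; lia.
(* Stage k alters only variables of weight [4 (d + k)], so one of weight m is settled by stage m +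
   1; the variables x are never altered. *)
pose age (w : V) : nat := if w is inl v then (qweight (val v)).+1 else 0%N.
pose y' w := Y (age w) w.
have y'E k w : (age w <= k)%N -> Y k w = y' w.
  move=> ak; apply: Ystable => // v e; rewrite e /=; lia.
have mevE p : exists k0, forall k, (k0 <= k)%N -> mev (Y k) p = mev y' p.
  exists (\max_(w <- mvars p) age w)%N => k k0k; apply: eq_meval => m mp w wm.
  apply: y'E; apply: leq_trans k0k; apply: leq_bigmax_seq => //.
  exact: mem_mvars mp wm.
exists y'; split.
- move=> e g ge; have [k0 Hk] := mevE (mnorm E g).
  rewrite -(Hk (maxn k0 e)) ?leq_maxl //.
  apply: (gs_pos_ball_le _ (YP _).1) ge.
  by rewrite (leq_trans (leq_maxr k0 e)) // leq_addl.
- by have [k0 Hk] := mevE h; rewrite -(Hk k0) //; exact: (YP k0).2.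
- move=> w hw; rewrite -[y w]/(Y 0%N w); apply: Ystable => // v e.
  by rewrite addn0; exact: hw.
Qed.

Lemma in_Rx_mmon (k : {cmonom V}) : (forall w, w \in finsupp k -> exists i, w = inr i) -> mmon k = mone.
Proof.
move=> hk; apply/eqP/cmP => -[b|i]; rewrite ?mmon_inr cm1 // mmon_inl.
by apply/eqP; rewrite cmE_eq0; apply/negP => /hk[].
Qed.

Lemma in_Rx_sqr (p : M) : in_Rx p -> in_Rx (p ^+ 2).
Proof.
move=> hp k; rewrite expr2 => /msuppM_le[k1 [k2 [h1 h2 ->]]] w.
by rewrite mdomD in_fsetU => /orP[]; exact: hp.
Qed.

Lemma gs_pos_pseudo_moment y : (forall e, gs_pos y (qball e)) ->
  pseudo_moment_eval (mev y).
Proof.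
move=> pos; split; [exact: (rmorphD (mev y))|exact: (rmorphM (mev y))|exact: rmorph1| |].
  by move=> c p; rewrite /mev mevalZ.
move=> p hp; pose D := (\max_(k <- msupp p) qweight (xpart k))%N.
apply: (@gram_schmidt_ge0 _ E _ (mev y) (map (@xpow R n) (qball D.+1)) p (pos _)).
have -> : p = \sum_(k <- msupp p) (p@_k)%:MP * xpow R (xpart k).
  rewrite {1}[p]monalgE; apply: eq_big_seq => k kp.
  have kE : k = xmon (xpart k) by rewrite [LHS]mmon_xmon (in_Rx_mmon (hp k kp)) mul1m.
  by rewrite /xpow -kE; exact: malgU_mul.
rewrite big_seq; elim/big_ind: _ => [|u w hu hw|k kp].
- exact: Span0.
- exact: span_add.
apply: (span_scale (is_scalar_ring E)); first exact: mscalarC.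
apply: (span_mem (is_scalar_ring E)); apply: map_f; rewrite mem_qball ltnS.
exact: leq_bigmax_seq.
Qed.

Lemma pseudo_moment_mev (phi : M -> R) : pseudo_moment_eval phi ->
  forall p, phi p = mev (fun v => phi << ucm v >>) p.
Proof.
case=> phiD phiM phi1 phiZ _.
have phiB : zmod_morphism phi.
  by move=> p q; rewrite -scaleN1r phiD phiZ mulN1r.
have phiMM : monoid_morphism phi by [].
pose s : {rmorphism M -> R} := HB.pack phi
  (GRing.isZmodMorphism.Build _ _ phi phiB) (GRing.isMonoidMorphism.Build _ _ phi phiMM).
move=> p; apply: (meval_rmorph (s := s)) => c.
by rewrite -[LHS]/(phi c%:MP) -[c%:MP]mulr1 mul_malgC phiZ phi1 mulr1.
Qed.

(** On [R[x]] the map m gives expressions of degree at most one in the moments; the constant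
    [m_0 = 1] fits because the two weights add up to 1. *)
Lemma mev_mm_affine y0 y1 t p : in_Rx p ->
  mev (fun w => (1 - t) * y0 w + t * y1 w) (mm p) =
  (1 - t) * mev y0 (mm p) + t * mev y1 (mm p).
Proof.
move=> hp; rewrite /mm !rmorph_sum !mulr_sumr -big_split; apply: eq_big_seq => k kp.
have mp1 : mpart R k = 1 by rewrite mpartE (in_Rx_mmon (hp k kp)).
rewrite mp1 mul1r /= -!/(mev _ _).
have mevZ u c (q : M) : mev u (c *: q) = c * mev u q by rewrite /mev mevalZ.
rewrite [LHS]mevZ [X in _ = _ * X + _]mevZ [X in _ = _ + _ * X]mevZ.
have [->|a1] := eqVneq (xpart k) mone.
  by rewrite mvar1 !rmorph1; ring.
by rewrite (mvarN1 R a1) !mev_var; ring.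
Qed.

Lemma pseudo_moment_convex y0 y1 t : 0 <= t <= 1 ->
  pseudo_moment_eval (mev y0) -> pseudo_moment_eval (mev y1) ->
  pseudo_moment_eval (mev (fun w => (1 - t) * y0 w + t * y1 w)).
Proof.
case/andP=> t0 t1 [_ _ _ _ pos0] [_ _ _ _ pos1]; set y := fun w => _.
split; [exact: (rmorphD (mev y))|exact: (rmorphM (mev y))|exact: rmorph1| |].
  by move=> c p; rewrite /mev mevalZ.
move=> p hp; rewrite mev_mm_affine; last exact: in_Rx_sqr.
by rewrite addr_ge0 // mulr_ge0 ?subr_ge0 // (pos0, pos1).
Qed.

(* Specialising the coefficients of u at y turns m(u^2) into m of a square in R[x]. *)
Lemma pseudo_moment_sqr_ge0 y u : pseudo_moment_eval (mev y) -> 0 <= mev y (mm (u ^+ 2)).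
Proof.
case=> _ _ _ _ pos.
pose hs (w : V) : M := if w is inl _ then (y w)%:MP else << ucm w >>.
pose sp : {rmorphism M -> M} := meval (@malgC {cmonom V} R) hs.
have sp1 m : sp << m >> = moneval hs m.
  by rewrite -[RHS]mul1r; exact: mevalU.
have mev1 m : mev y << m >> = moneval y m.
  by rewrite -[RHS]mul1r; exact: mevalU.
have spU k : sp << k >> = mev y (mpart R k) *: xpow R (xpart k).
  have spm : sp (mpart R k) = (mev y (mpart R k))%:MP.
    rewrite mpartE sp1 mev1 /moneval [RHS](rmorph_prod (@malgC {cmonom V} R)).
    apply: eq_big_seq => -[b|i] wk; first by rewrite [RHS](rmorphXn (@malgC {cmonom V} R)).
    by exfalso; move: wk; rewrite -cmE_neq0 mmon_inr.
  have spx : sp (xpow R (xpart k)) = xpow R (xpart k).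
    rewrite [LHS]sp1 [RHS]malgU_moneval; apply: eq_moneval => -[b|i] wk; last exact: erefl.
    by exfalso; move: wk; rewrite -cmE_neq0 xmon_inl.
  rewrite (malgU_mpart R k) [LHS](rmorphM sp) spm spx; exact: mul_malgC.
have spZ c q : sp (c *: q) = c *: sp q.
  exact: etrans (mevalZ _ _ _ _) (mul_malgC _ _).
have spE q : sp q = \sum_(k <- msupp q) (q@_k * mev y (mpart R k)) *: xpow R (xpart k).
  rewrite {1}[q]monalgE rmorph_sum; apply: eq_bigr => k _.
  by rewrite malgU_scale spZ spU scalerA.
have mmZ c (q : M) : mm (c *: q) = c *: mm q.
  rewrite -[c *: q]mul_malgC -[RHS]mul_malgC; apply: mm_scalarM; exact: mscalarC.
have mevZ z c (q : M) : mev z (c *: q) = c * mev z q by rewrite /mev mevalZ.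
have mm_sp q : mev y (mm (sp q)) = mev y (mm q).
  rewrite spE mm_sum [LHS](rmorph_sum (mev y)) [RHS](rmorph_sum (mev y)).
  apply: eq_bigr => k _.
  rewrite mmZ mm_xpow [LHS]mevZ [RHS]mevZ -[LHS]mulrA; congr (_ * _).
  exact/esym/(rmorphM (mev y)).
rewrite -mm_sp (rmorphXn sp); apply: pos => k.
rewrite spE => ksp w wk; case: w wk => [b|i]; last by exists i.
rewrite -cmE_neq0 => /negP[]; move: ksp; rewrite -mcoeff_neq0 raddf_sum /=.
apply: contraNT => kb; rewrite big1 // => l _.
rewrite mcoeffZ mcoeffU1; case: eqP => [e|_]; last by rewrite mulr0.
by move: kb; rewrite -e xmon_inl.
Qed.

Lemma Omega_hat_ge0 y g : pseudo_moment_eval (mev y) -> Omega_hat g -> 0 <= mev y g.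
Proof.
move=> py [s ->]; rewrite rmorph_sum; apply: sumr_ge0 => t _.
rewrite (rmorphM (mev y)) (rmorphXn (mev y)) mulr_ge0 ?sqr_ge0 // rmorph_prod.
by apply: prodr_ge0 => u _; exact: pseudo_moment_sqr_ge0.
Qed.

Lemma pseudo_moment_dense h : h != 0 -> exists y,
  [/\ pseudo_moment_eval (mev y), mev y h != 0 & forall e, gs_pos y (qball e)].
Proof.
move=> h0; have [y yh] := malg_nonroot h0.
(* The ball of radius 0 is empty, so any nonroot of [h] may serve as the start. *)
have [y' [pos y'h _]] := @gs_pos_complete 0 y h (fun _ _ => ltac:(done)) yh.
by exists y'; split=> //; exact: gs_pos_pseudo_moment.
Qed.

End MomentExtension.

(** * The Positivstellensatz *)

Section FractionCone.
Variables (A : comNzRingType) (L : closedFieldType) (iota : {rmorphism A -> L}).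
Variable P : A -> Prop.
Hypothesis iota0 : forall p, iota p = 0 -> p = 0.
Hypothesis PD : forall p q, P p -> P q -> P (p + q).
Hypothesis PM : forall p q, P p -> P q -> P (p * q).
Hypothesis Psqr : forall p, P (p ^+ 2).
Hypothesis Pproper : forall q, q != 0 -> ~ P (- q ^+ 2).

(** The denominators are squares and do not affect signs: -1 has this form only if P contains some
    [- q^2] with [q != 0]. *)
Definition fraction_cone : set L := fun x =>
  exists p q, [/\ P p, q != 0 & x = iota p / iota q ^+ 2].

Let iota_neq0 q : q != 0 -> iota q != 0.
Proof. by apply: contraNneq => /iota0->. Qed.

Let dom (p q : A) : p != 0 -> q != 0 -> p * q != 0.
Proof.
move=> /iota_neq0 p0 /iota_neq0 q0.
by apply: contraTneq (mulf_neq0 p0 q0) => e; rewrite -rmorphM e rmorph0 eqxx.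
Qed.

Lemma fraction_coneP : cone fraction_cone.
Proof.
split.
- exists 1, 1; rewrite rmorph1 expr1n divr1 oner_eq0; split=> //.
  by rewrite -(expr1n _ 2); exact: Psqr.
- move=> x y [p [q [Op q0 ->]]] [p' [q' [Op' q'0 ->]]].
  exists (p * q' ^+ 2 + p' * q ^+ 2), (q * q'); split.
  + by apply: (PD); apply: (PM) => //; exact: Psqr.
  + exact: dom.
  + have iq := iota_neq0 q0; have iq' := iota_neq0 q'0.
    rewrite (rmorphD iota) !(rmorphM iota).
    by move: (iota p) (iota p') (iota q) (iota q') iq iq' => a b c d c0 d0; field; rewrite c0 d0.
- move=> x y [p [q [Op q0 ->]]] [p' [q' [Op' q'0 ->]]].
  exists (p * p'), (q * q'); split; [exact: PM|exact: dom|].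
  by rewrite !(rmorphM iota) mulf_div exprMn.
- move=> x y [p [q [Op q0 ->]]] [p' [q' [Op' q'0 ->]]].
  exists ((p * q' ^+ 2 - p' * q ^+ 2) ^+ 2), ((q * q') ^+ 2); split.
  + exact: Psqr.
  + by rewrite expr2 !dom.
  + have iq := iota_neq0 q0; have iq' := iota_neq0 q'0.
    rewrite !(rmorphXn iota) (rmorphB iota) !(rmorphM iota).
    by move: (iota p) (iota p') (iota q) (iota q') iq iq' => a b c d c0 d0; field; rewrite c0 d0.
- move=> x [p [q [Op q0 ->]]]; have [p0|p0] := eqVneq p 0.
    exists p, q; split=> //; by rewrite p0 rmorph0 mul0r invr0.
  exists (p * q ^+ 2), p; split=> //.
    by apply: (PM) => //; exact: Psqr.
  have ip := iota_neq0 p0; have iq := iota_neq0 q0.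
  rewrite !(rmorphM iota).
  by move: (iota p) (iota q) ip iq => a c a0 c0; field; rewrite a0 c0.
- case=> p [q [Op q0 e]]; apply: (Pproper q0).
  suff <- : p = - q ^+ 2 by [].
  apply/eqP; rewrite -addr_eq0; apply/eqP/iota0.
  have iq := iota_neq0 q0; rewrite (rmorphD iota) (rmorphXn iota).
  have -> : iota p = -1 * iota q ^+ 2 by rewrite e divfK // expf_neq0.
  by rewrite mulN1r addNr.
Qed.

(** Again [p = ((p+1)/2)^2 - ((p-1)/2)^2]. If 2 were 0, then [-1 = 1] would be a square, against
    [Pproper]. *)
Lemma fraction_cone_diff p : cone_diff fraction_cone (iota p).
Proof.
have two0 : (2 : A) != 0.
  apply/eqP => two0; apply: (Pproper (oner_neq0 A)).
  have -> : - 1 ^+ 2 = 1 ^+ 2 :> A; last exact: Psqr.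
  by apply/eqP; rewrite expr1n eq_sym -addr_eq0 -[_ + _]/(2%:R) two0.
exists (iota ((p + 1) ^+ 2) / iota 2 ^+ 2), (iota ((p - 1) ^+ 2) / iota 2 ^+ 2); split.
- by exists ((p + 1) ^+ 2), 2; split=> //; exact: Psqr.
- by exists ((p - 1) ^+ 2), 2; split=> //; exact: Psqr.
have := iota_neq0 two0; rewrite !(rmorphXn iota) (rmorphB iota) (rmorphD iota) (rmorph1 iota) (rmorph_nat iota).
move: (iota p) => a two; field.
by rewrite -[4%N]/(2 * 2)%N natrM mulf_neq0.
Qed.

Lemma fraction_cone_mem p : P p -> fraction_cone (iota p).
Proof. by exists p, 1; rewrite rmorph1 expr1n divr1 oner_eq0. Qed.

End FractionCone.

Lemma sum_sqr_prodM (A : comNzRingType) (F : A -> A) (s s' : seq (A * seq A)) :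
  (\sum_(t <- s) t.1 ^+ 2 * \prod_(u <- t.2) F u) *
  (\sum_(t <- s') t.1 ^+ 2 * \prod_(u <- t.2) F u) =
  \sum_(t <- [seq (t.1 * u.1, t.2 ++ u.2) | t <- s, u <- s'])
     t.1 ^+ 2 * \prod_(u <- t.2) F u.
Proof.
rewrite big_allpairs_dep /= mulr_suml; apply: eq_bigr => t _.
rewrite mulr_sumr; apply: eq_bigr => u _.
by rewrite big_cat /= exprMn mulrACA.
Qed.

(** * The preordering of the moment squares and the two implications *)

Section OmegaHat.
Variables (R : realType) (n : nat).
Local Notation M := (Mx R n).
Implicit Types (f g h p q : M).

Lemma Omega_hat0 : Omega_hat (0 : M).
Proof. by exists [::]; rewrite big_nil. Qed.

Lemma Omega_hatD g h : Omega_hat g -> Omega_hat h -> Omega_hat (g + h).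
Proof. by move=> [s ->] [s' ->]; exists (s ++ s'); rewrite big_cat. Qed.

Lemma Omega_hat_sqr g : Omega_hat (g ^+ 2).
Proof. by exists [:: (g, [::])]; rewrite big_seq1 big_nil mulr1. Qed.

Lemma Omega_hat_mm_sqr g : Omega_hat (mm (g ^+ 2)).
Proof. by exists [:: (1, [:: g])]; rewrite big_seq1 big_seq1 expr1n mul1r. Qed.

Lemma Omega_hatM g h : Omega_hat g -> Omega_hat h -> Omega_hat (g * h).
Proof.
move=> [s ->] [s' ->]; exists [seq (t.1 * u.1, t.2 ++ u.2) | t <- s, u <- s'].
exact: sum_sqr_prodM.
Qed.

Lemma Omega_hat_quotient_ge0 f g h (phi : M -> R) :
  Omega_hat g -> Omega_hat h -> h != 0 -> h * f = g ->
  pseudo_moment_eval phi -> 0 <= phi f.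
Proof.
move=> Og Oh h0 hfg pphi; pose y0 v := phi << ucm v >>.
have phiE : phi = mev y0 by apply/funext => p; exact: pseudo_moment_mev.
rewrite phiE in pphi *; rewrite leNgt; apply/negP => f0.
have [y1 [py1 y1h _]] := pseudo_moment_dense h0.
(* Along the segment [f] and [h] become polynomials with [F(0) < 0] and [H(1) != 0]. A small t has
   [F(t) < 0] and [H(t) != 0], against [H(t) >= 0] and [H(t) F(t) >= 0]. *)
have [F FE] := mev_lineE y0 y1 f; have [H HE] := mev_lineE y0 y1 h.
have H0 : H != 0.
  apply: contraNneq y1h => H0; have := HE 1; rewrite H0 horner0 => <-.
  by apply/eqP/eq_meval => k _ w _; rewrite subrr mul0r add0r mul1r.
have F0 : F.[0] < 0.
  rewrite -FE (_ : mev _ f = mev y0 f) //.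
  by apply: eq_meval => k _ w _; rewrite subr0 mul1r mul0r addr0.
have [|d d0 Fd] := @poly_cont R 0 F (- F.[0]); first by rewrite oppr_gt0.
have [|t /andP[t0]] := @poly_nonroot_itv _ H (Num.min d 1) H0; first by rewrite lt_min d0 ltr01.
rewrite lt_min => /andP[td t1] Ht.
have Ft : F.[t] < 0.
  have := Fd t; rewrite subr0 ger0_norm ?(ltW t0) // => /(_ td).
  by rewrite ltr_norml opprK => /andP[_]; rewrite ltrBlDr addNr.
have pyt := pseudo_moment_convex (t := t) _ pphi py1.
have t01 : 0 <= t <= 1 by rewrite !ltW.
have := Omega_hat_ge0 (pyt t01) Og; have := Omega_hat_ge0 (pyt t01) Oh.
rewrite -hfg (rmorphM (mev _)) FE HE => Ht0.
by rewrite pmulr_rge0 ?leNgt ?Ft // lt_def Ht.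
Qed.

Lemma mx_closed_field_embedding : exists (L : closedFieldType) (iota : {rmorphism M -> L}),
  forall p, iota p = 0 -> p = 0.
Proof.
pose I : pointedType := HB.pack (Var n -> R) (isPointed.Build (Var n -> R) (fun=> 0))
  (Choice.on {classic (Var n -> R)}).
pose C : closedFieldType := R[i].
pose e (y : I) : {rmorphism M -> C} := (real_complex R \o mev y)%FUN.
apply: (@closed_field_embedding M C I e) => [p q|p p0]; first exact: malg_mulf_neq0.
have [y py] := malg_nonroot p0; exists y.
by rewrite /e /= fmorph_eq0.
Qed.

(** The preordering generated by [Omega_hat] and [-f]. *)
Definition Omega_minus f p := exists g h, [/\ Omega_hat g, Omega_hat h & p = g - f * h].

Lemma Omega_minusD f p q : Omega_minus f p -> Omega_minus f q -> Omega_minus f (p + q).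
Proof.
move=> [g [h [Og Oh ->]]] [g' [h' [Og' Oh' ->]]]; exists (g + g'), (h + h').
split; [exact: Omega_hatD|exact: Omega_hatD|].
by rewrite mulrDr opprD addrACA.
Qed.

Lemma Omega_minusM f p q : Omega_minus f p -> Omega_minus f q -> Omega_minus f (p * q).
Proof.
move=> [g [h [Og Oh ->]]] [g' [h' [Og' Oh' ->]]].
exists (g * g' + f ^+ 2 * (h * h')), (g * h' + h * g').
have OM := Omega_hatM; have OD := Omega_hatD; split.
- by apply: (OD); [exact: OM|apply: (OM); [exact: Omega_hat_sqr|exact: OM]].
- by apply: (OD); exact: OM.
- by ring.
Qed.

Lemma Omega_minus_hat f g : Omega_hat g -> Omega_minus f g.
Proof. by exists g, 0; split; [|exact: Omega_hat0|rewrite mulr0 subr0]. Qed.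

Lemma Omega_minus_sqr f p : Omega_minus f (p ^+ 2).
Proof. exact/Omega_minus_hat/Omega_hat_sqr. Qed.

Lemma Omega_minus_proper f q :
  ~ (exists g h, [/\ Omega_hat g, Omega_hat h, h != 0 & h * f = g]) ->
  q != 0 -> ~ Omega_minus f (- q ^+ 2).
Proof.
move=> nonquot q0 [g [h [Og Oh e]]].
have fh : f * h = g + q ^+ 2 by rewrite -[q ^+ 2]opprK e opprB addrCA subrr addr0.
have [h0|h0] := eqVneq h 0; last first.
  apply: nonquot; exists (g + q ^+ 2), h; rewrite mulrC; split=> //.
  exact/Omega_hatD/Omega_hat_sqr.
have [y [py yq _]] := pseudo_moment_dense q0.
have := Omega_hat_ge0 py Og; have -> : g = - q ^+ 2 by rewrite e h0 mulr0 subr0.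
rewrite (rmorphN (mev y)) (rmorphXn (mev y)) oppr_ge0 => le0.
by move: yq; rewrite -sqrf_eq0 eq_le le0 sqr_ge0.
Qed.

Lemma ge0_Omega_hat_quotient f :
  (forall phi : M -> R, pseudo_moment_eval phi -> 0 <= phi f) ->
  exists g h, [/\ Omega_hat g, Omega_hat h, h != 0 & h * f = g].
Proof.
move=> fpos; apply: contrapT => nonquot.
have f0 : f != 0.
  apply/eqP => f0; apply: nonquot; exists 0, 1; rewrite f0 mulr0 oner_eq0.
  by split=> //; [exact: Omega_hat0|rewrite -(expr1n _ 2); exact: Omega_hat_sqr].
have [L [iota iota0]] := mx_closed_field_embedding.
have [K [s [sge0 s0]]] := cone_real_closed
  (fraction_coneP iota0 (@Omega_minusD f) (@Omega_minusM f) (@Omega_minus_sqr f)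
    (fun q => @Omega_minus_proper f q nonquot))
  (fraction_cone_diff iota0 (@Omega_minus_sqr f) (fun q => @Omega_minus_proper f q nonquot)).
have sO p : Omega_minus f p -> p != 0 -> 0 < s p.
  move=> Op p0; rewrite lt_def sge0 ?andbT; last exact: fraction_cone_mem.
  by apply: contraNneq p0 => /s0/iota0->.
have sf : s f < 0.
  rewrite -oppr_gt0 -rmorphN; apply: sO; last by rewrite oppr_eq0.
  exists 0, 1; rewrite mulr1 sub0r; split=> //; first exact: Omega_hat0.
  by rewrite -(expr1n _ 2); exact: Omega_hat_sqr.
have sN l g : g \in gram_schmidt (moment_expectation R n) (map (@xpow R n) (qball n l)) ->
    0 < s (mnorm (moment_expectation R n) g).
  move=> gG; apply: sO; first exact/Omega_minus_hat/Omega_hat_mm_sqr.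
  (* The norm is not the zero polynomial, since some pseudo-moment evaluation makes it positive. *)
  have [y [_ _ /(_ l) pos]] := pseudo_moment_dense (oner_neq0 M).
  by apply: contraTneq (pos g gG) => ->; rewrite rmorph0 ltxx.
pose j : {rmorphism R -> K} := (s \o @malgC {cmonom (Var n)} R)%FUN.
pose z v := s << ucm v >>.
have sE p : s p = meval j z p by exact: meval_rmorph.
pose qv (v : Var n) := if v is inl b then qweight (val b) else 0%N.
(* All variables of [f] have weight below [d], and the completion changes only variables of weight
   at least [4 d]; hence it leaves the value of [f] alone. *)
pose d := (\max_(v <- mvars f) qv v).+1.
pose ps := f :: map (mnorm (moment_expectation R n))
  (gram_schmidt (moment_expectation R n) (map (@xpow R n) (qball n d))).
have [y hy] := malg_transfer j z ps.
have yf : mev y f < 0.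
  by rewrite -sgz_lt0 hy ?mem_head // -sE sgz_lt0.
have ypos : gs_pos y (qball n d).
  move=> g gG; rewrite -sgz_gt0 hy; last by rewrite in_cons map_f ?orbT.
  by rewrite -sE sgz_gt0; exact: sN gG.
have [|y' [pos _ agree]] := @gs_pos_complete R n d y 1 ypos.
  by rewrite rmorph1 oner_eq0.
have := fpos _ (gs_pos_pseudo_moment pos); rewrite leNgt.
rewrite (_ : mev y' f = mev y f) ?yf //.
apply: eq_meval => k kf v vk; apply: agree => b e.
have : (qv v < d)%N.
  by rewrite ltnS; apply: leq_bigmax_seq => //; exact: mem_mvars kf vk.
by rewrite e /= => lt; apply: leq_trans lt _; rewrite leq_pmull.
Qed.

End OmegaHat.

Theorem theorem3p7 (R : realType) (n : nat) (f : Mx R n) :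
  (forall phi : Mx R n -> R, pseudo_moment_eval phi -> 0 <= phi f) <->
  (exists g h : Mx R n,
      [/\ Omega_hat g, Omega_hat h, h != 0 & h * f = g]).
Proof.
split; first exact: ge0_Omega_hat_quotient.
by move=> [g [h [Og Oh h0 e]]] phi; exact: Omega_hat_quotient_ge0 Og Oh h0 e.
Qed.
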